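(* Let $\mathfrak g=\mathfrak{vect}(0|n)$ or $\mathfrak g=\mathfrak{svect}(0|n)$ for $n\ge3$, or $\mathfrak g=\widetilde{\mathfrak{svect}}(0|2n)$ for $n\ge2$. Let $\mathfrak s_{-1}\subsetneq\mathfrak g_{-1}$ be any non-zero proper subspace and let $\mathfrak s_0$ be a maximal solvable Lie subalgebra of $\mathfrak g_0$ preserving $\mathfrak s_{-1}$. Then the prolong $(\mathfrak s_{-1},\mathfrak s_0)_*^{\mathfrak g}$ is maximal solvable in $\mathfrak g$.
   Context: The ground field is $\mathbb C$; all spaces are finite-dimensional. $\Lambda(n)$ is the Grassmann algebra on generators $\xi_1,\dots,\xi_n$, graded by $\deg\xi_i=1$, with parity $p$ equal to the degree modulo 2. $\mathfrak{vect}(0|n)$ is the Lie superalgebra of superderivations $\sum f_i\partial_i$ of $\Lambda(n)$, where $f_i\in\Lambda(n)$ and $\partial_i\xi_j=\delta_{ij}$, with $\mathbb Z$-grading $\deg(f\partial_i)=\deg f-1$. $\mathfrak{svect}(0|n)=\{D\in\mathfrak{vect}(0|n)\mid \mathrm{Div}\,D=0\}$, where $\mathrm{Div}(\sum f_i\partial_i)=\sum(-1)^{p(f_i)}\partial_i(f_i)$, with the induced grading. With $2n$ generators $\xi_1,\dots,\xi_{2n}$ and $\Xi=\xi_1\cdots\xi_{2n}$, put $\widetilde{\mathfrak{svect}}(0|2n)=(1+\Xi)\,\mathfrak{svect}(0|2n)\subset\mathfrak{vect}(0|2n)$. It is $\mathbb Z/2n\mathbb Z$-graded with degrees represented by $-1,0,\dots,2n-2$: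 the degree $-1$ component is $\mathrm{Span}((1+\Xi)\partial_1,\dots,(1+\Xi)\partial_{2n})$, and the degree $i$ component is $\mathfrak{svect}_i(0|2n)$ for $i\ge0$. A Lie subsuperalgebra $\mathfrak s\subset\mathfrak g$ is graded if $\mathfrak s=\bigoplus_i(\mathfrak s\cap\mathfrak g_i)$. ''Maximal solvable in $\mathfrak g$'' means: solvable, graded, and not properly contained in any graded solvable Lie subsuperalgebra of $\mathfrak g$. ''Maximal solvable subalgebra of $\mathfrak g_0$ preserving $\mathfrak s_{-1}$'' means a subalgebra $\mathfrak s_0$ with $[\mathfrak s_0,\mathfrak s_{-1}]\subset\mathfrak s_{-1}$ that is maximal among solvable subalgebras of $\mathfrak g_0$ with this property. Prolong: $(\mathfrak s_{-1},\mathfrak s_0)_*^{\mathfrak g}:=\bigoplus_{k\ge-1}\mathfrak s_k$ with the given $\mathfrak s_{-1},\mathfrak s_0$ and, recursively for $k\ge1$, $\mathfrak s_k:=\{D\in\mathfrak g_k\mid[D,\mathfrak s_{-1}]\subset\mathfrak s_{k-1}\}$. For $\widetilde{\mathfrak{svect}}(0|2n)$, $k$ runs over the representatives $-1,0,\dots,2n-2$ of the degrees. *)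

(* Defs.v *)
From HB Require Import structures.
From mathcomp Require Import all_boot all_order all_algebra.
From mathcomp Require Import reals complex.

Set Implicit Arguments.
Unset Strict Implicit.
Unset Printing Implicit Defensive.

Import Order.TTheory GRing.Theory Num.Theory.
Local Open Scope ring_scope.

(* The sign (-1) ^ inversions A B is the one needed to put xi_A xi_B in
   increasing order, for disjoint A and B. *)
Definition inversions (n : nat) (A B : {set 'I_n}) : nat :=
  #|[set p : 'I_n * 'I_n | [&& p.1 \in A, p.2 \in B & (p.2 < p.1)%N]]|.

(* The Grassmann algebra on xi_0, ..., xi_(n-1): f A is the coefficient of the
   monomial xi_A, the product of the xi_a, a in A, in increasing order. *)
Definition grassmann (K : fieldType) (n : nat) : Type := {ffun {set 'I_n} -> K^o}.

Section Grassmann.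
Variables (K : fieldType) (n : nat).
Local Notation L := (grassmann K n).
Implicit Types (A B C D : {set 'I_n}).

HB.instance Definition _ := Vector.copy L {ffun {set 'I_n} -> K^o}.

Definition grassmann_one : L := [ffun A => (A == set0)%:R].
Definition grassmann_mul (f g : L) : L :=
  [ffun C : {set 'I_n} =>
     \sum_(A : {set 'I_n} | A \subset C) (-1) ^+ inversions A (C :\: A) * (f A * g (C :\: A))].

Lemma inversions0l A : inversions set0 A = 0%N.
Proof. by apply: eq_card0 => p; rewrite !inE. Qed.

Lemma inversions0r A : inversions A set0 = 0%N.
Proof. by apply: eq_card0 => p; rewrite !inE andbF. Qed.

Lemma inversionsUl A B C : [disjoint A & B] ->
  inversions (A :|: B) C = (inversions A C + inversions B C)%N.
Proof.
move=> dAB; rewrite /inversions -cardsUI [X in (_ + X)%N]eq_card0 => [|p].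
  by rewrite addn0; apply: eq_card => p; rewrite !inE -andb_orl.
rewrite !inE; apply/negP => /andP[/and3P[pA _ _] /and3P[pB _ _]].
by move/pred0P/(_ p.1): dAB; rewrite /= pA pB.
Qed.

Lemma inversionsUr A B C : [disjoint B & C] ->
  inversions A (B :|: C) = (inversions A B + inversions A C)%N.
Proof.
move=> dBC; rewrite /inversions -cardsUI [X in (_ + X)%N]eq_card0 => [|p].
  by rewrite addn0; apply: eq_card => p; rewrite !inE -andb_orr -andb_orl.
rewrite !inE; apply/negP => /andP[/and3P[_ pB _] /and3P[_ pC _]].
by move/pred0P/(_ p.2): dBC; rewrite /= pB pC.
Qed.

Fact grassmann_mulA : associative grassmann_mul.
Proof.
move=> f g h; apply/ffunP => D; rewrite !ffunE.
under eq_bigr do rewrite ffunE mulr_sumr mulr_sumr.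
under [RHS]eq_bigr do rewrite ffunE mulr_suml mulr_sumr.
rewrite [RHS](exchange_big_dep (fun A => A \subset D)) /=; last first.
  by move=> C A sCD sAC; apply: subset_trans sCD.
apply: eq_bigr => A sAD.
rewrite [RHS](reindex_onto (fun B => A :|: B) (fun C => C :\: A)) /=; last first.
  by move=> C /andP[_ sAC]; rewrite -{2}(setID C A) (setIidPr sAC).
apply: eq_big => [B|B sB].
  rewrite subUset sAD subsetUl setDUl setDv set0U subsetD andbT /=.
  by congr (_ && _); apply/idP/eqP => [/setDidPl|<-] //; rewrite -setI_eq0; apply/eqP/setP => x; rewrite !inE; case: (x \in A); rewrite ?andbF.
have dAB : [disjoint A & B] by move: sB; rewrite subsetD disjoint_sym => /andP[].
have sBD : B \subset D by move: sB; rewrite subsetD => /andP[].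
have -> : (A :|: B) :\: A = B.
  by rewrite setDUl setDv set0U; apply/setDidPl; rewrite disjoint_sym.
have -> : D :\: A :\: B = D :\: (A :|: B) by rewrite setDDl.
have DAB : D :\: A = B :|: (D :\: (A :|: B)).
  by rewrite -setDDl -{1}(setID (D :\: A) B) (setIidPr sB).
have dB : [disjoint B & D :\: (A :|: B)].
  by rewrite -setI_eq0; apply/eqP/setP => x; rewrite !inE; case: (x \in B); rewrite ?orbT.
rewrite [in inversions A _]DAB inversionsUr // inversionsUl // !exprD -!mulrA.
have mulE (a b c d e : K) : a * (b * (c * (d * e))) = b * (d * (a * (c * e))).
  by rewrite mulrCA; congr (_ * _); rewrite [c * _]mulrCA mulrCA.
exact: mulE.
Qed.

Fact grassmann_mul1l : left_id grassmann_one grassmann_mul.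
Proof.
move=> f; apply/ffunP => C; rewrite ffunE (bigD1 set0) ?sub0set //= ffunE eqxx.
rewrite inversions0l setD0 !mul1r big1 ?addr0 // => A /andP[_ /negPf A0].
by rewrite ffunE A0 mul0r mulr0.
Qed.

Fact grassmann_mul1r : right_id grassmann_one grassmann_mul.
Proof.
move=> f; apply/ffunP => C; rewrite ffunE (bigD1 C) //= ffunE setDv eqxx.
rewrite inversions0r mulr1 mul1r big1 ?addr0 // => A /andP[sAC nAC].
rewrite ffunE setD_eq0 (_ : C \subset A = false) ?mulr0 //.
by apply: contraNF nAC => sCA; rewrite eqEsubset sAC.
Qed.

Fact grassmann_mulDl : left_distributive grassmann_mul +%R.
Proof.
move=> f g h; apply/ffunP => C; rewrite !ffunE -big_split /=.
by apply: eq_bigr => A _; rewrite ffunE mulrDl mulrDr.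
Qed.

Fact grassmann_mulDr : right_distributive grassmann_mul +%R.
Proof.
move=> f g h; apply/ffunP => C; rewrite !ffunE -big_split /=.
by apply: eq_bigr => A _; rewrite ffunE mulrDr mulrDr.
Qed.

Fact grassmann_oner_neq0 : grassmann_one != 0.
Proof. by apply/eqP => /ffunP/(_ set0)/eqP; rewrite !ffunE eqxx oner_eq0. Qed.

HB.instance Definition _ := GRing.Zmodule_isNzRing.Build L
  grassmann_mulA grassmann_mul1l grassmann_mul1r
  grassmann_mulDl grassmann_mulDr grassmann_oner_neq0.

Fact grassmann_scaleAl (k : K) (f g : L) : k *: (f * g) = (k *: f) * g.
Proof.
apply/ffunP => C; rewrite !ffunE scaler_sumr; apply: eq_bigr => A _.
have -> : (k *: f) A = k * f A by rewrite ffunE.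
have mulE (a b c : K) : k * (a * (b * c)) = a * (k * b * c).
  by rewrite mulrCA [k * (b * c)]mulrA.
exact: mulE.
Qed.

Fact grassmann_scaleAr (k : K) (f g : L) : k *: (f * g) = f * (k *: g).
Proof.
apply/ffunP => C; rewrite !ffunE scaler_sumr; apply: eq_bigr => A _.
have -> : (k *: g) (C :\: A) = k * g (C :\: A) by rewrite ffunE.
have mulE (a b c : K) : k * (a * (b * c)) = a * (b * (k * c)).
  by rewrite mulrCA [k * (b * c)]mulrCA.
exact: mulE.
Qed.

HB.instance Definition _ := GRing.Lmodule_isLalgebra.Build K L grassmann_scaleAl.
HB.instance Definition _ := GRing.Lalgebra_isAlgebra.Build K L grassmann_scaleAr.

End Grassmann.

Section VectorFields.
Variables (K : fieldType) (n : nat).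
Local Notation L := (grassmann K n).
Local Notation E := 'End(L).
Implicit Types (A B C : {set 'I_n}) (i j : 'I_n) (f g : L) (D : E) (U V W : {vspace E}).

Definition mono A : L := [ffun B => (B == A)%:R].
Definition xi i : L := mono [set i].
Definition Xi : L := \prod_(i < n) xi i.

Definition homog (d : int) : {vspace L} :=
  (\sum_(A : {set 'I_n} | #|A|%:Z == d) <[mono A]>)%VS.

Definition parity_part_fun (b : bool) f : L :=
  [ffun A : {set 'I_n} => if odd #|A| == b then f A else 0].
Fact parity_part_is_linear b : linear (parity_part_fun b).
Proof.
move=> k f g; apply/ffunP => A; rewrite !ffunE.
by case: eqP => _ //; rewrite scaler0 addr0.
Qed.
HB.instance Definition _ b :=
  GRing.isLinear.Build K L L *:%R (parity_part_fun b) (parity_part_is_linear b).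
Definition parity_part (b : bool) : E := linfun (parity_part_fun b).

(* The sign automorphism f |-> (-1) ^ p(f) f. *)
Definition parity_sign : E := parity_part false - parity_part true.

Definition below C i : nat := #|[set c in C | (c < i)%N]|.

(* The left partial derivative: d_i removes xi_i from a monomial, after moving
   it to the front across the smaller-indexed generators. *)
Definition pder_fun i f : L :=
  [ffun A : {set 'I_n} => if i \in A then 0
              else (-1) ^+ below A i * f (i |: A)].
Fact pder_is_linear i : linear (pder_fun i).
Proof.
move=> k f g; apply/ffunP => A; rewrite !ffunE.
case: ifP => _; first by rewrite scaler0 addr0.
by rewrite mulrDr -scalerAr.
Qed.
HB.instance Definition _ i :=
  GRing.isLinear.Build K L L *:%R (pder_fun i) (pder_is_linear i).
Definition pder i : E := linfun (pder_fun i).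

Lemma mono_mulE A f C : (mono A * f) C =
  if A \subset C then (-1) ^+ inversions A (C :\: A) * f (C :\: A) else 0 :> K.
Proof.
rewrite ffunE; case: ifP => sAC; last first.
  rewrite big1 // => B sBC; rewrite ffunE (_ : B == A = false) ?mul0r ?mulr0 //.
  by apply: contraFF sAC => /eqP <-.
rewrite (bigD1 A) //= big1 ?addr0 => [|B /andP[_ /negPf nBA]].
  by rewrite ffunE eqxx mul1r.
by rewrite ffunE nBA mul0r mulr0.
Qed.

Lemma belowU1 C i j : i \notin C -> below (i |: C) j = ((i < j) + below C j)%N.
Proof.
move=> niC; rewrite /below; case: (ltnP i j) => [ij|ji].
  rewrite (_ : [set c in _ | _] = i |: [set c in C | (c < j)%N]).
    by rewrite cardsU1 inE (negPf niC).
  by apply/setP => c; rewrite !inE; case: eqP => [->|].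
by apply: eq_card => c; rewrite !inE; case: eqP => [->|] //=; rewrite ltnNge ji andbF.
Qed.

Lemma belowD1 C i j : j \in C -> below C i = ((j < i) + below (C :\ j) i)%N.
Proof. by move=> jC; rewrite -belowU1 ?setD1K // !inE eqxx. Qed.

Fact pair_inj j : injective (fun i => (j, i)).
Proof. by move=> a b []. Qed.

Lemma xi_mulE j f C : (xi j * f) C =
  if j \in C then (-1) ^+ below C j * f (C :\ j) else 0 :> K.
Proof.
rewrite mono_mulE sub1set; case: ifP => // jC; congr (_ ^+ _ * _).
rewrite (belowD1 _ jC) ltnn add0n /below -(card_imset (mem [set c in C :\ j | (c < j)%N]) (@pair_inj j)).
apply: eq_card => -[a b]; apply/idP/imsetP => [|[c]].
  by rewrite !inE /= => /and3P[/eqP-> bC bj]; exists b; rewrite // !inE bC.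
by rewrite !inE => /andP[cC cj] [-> ->] /=; rewrite eqxx cC.
Qed.

Lemma pderE i f C : pder i f C =
  if i \in C then 0 else (-1) ^+ below C i * f (i |: C) :> K.
Proof. by rewrite lfunE ffunE. Qed.

(* pder1 and pder_xiM characterize d_i as the odd superderivation with
   d_i xi_j = delta_ij. *)
Lemma pder1 i : pder i 1 = 0.
Proof.
apply/ffunP => C; rewrite pderE !ffunE; case: ifP => // _.
by rewrite (_ : _ == set0 = false) ?mulr0 //; apply/eqP=> /setP/(_ i); rewrite !inE eqxx.
Qed.

Lemma pder_xiM i j f : pder i (xi j * f) = f *+ (i == j) - xi j * pder i f.
Proof.
apply/ffunP => C.
have -> : (f *+ (i == j) - xi j * pder i f) C
   = f C *+ (i == j) - (xi j * pder i f) C :> K.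
  by rewrite !ffunE; case: (i == j); rewrite ?ffunE.
rewrite pderE !xi_mulE pderE !inE.
have [->|nij] := eqVneq i j; rewrite ?eqxx /=.
  case: ifP => jC; last first.
    rewrite subr0 mulrA -exprD belowU1 ?jC // ltnn add0n addnn -mul2n exprM sqrrN expr1n.
    by rewrite expr1n mul1r setU1K ?jC.
  rewrite mulrA -exprD (belowD1 _ jC) ltnn add0n addnn -mul2n exprM sqrrN !expr1n.
  by rewrite mul1r setD1K ?subrr.
rewrite mulr0n sub0r.
case: ifP => [iC|/negbT niC]; first by rewrite mulr0 if_same oppr0.
case: ifP => jC; last by rewrite mulr0 oppr0.
rewrite belowU1 // (belowD1 _ jC) !mulrA -!exprD.
have -> : (i |: C) :\ j = i |: (C :\ j).
  by apply/setP => c; rewrite !inE; case: eqP => // ->; rewrite eq_sym (negPf nij).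
rewrite -mulNr; congr (_ * _).
rewrite -[RHS]mulN1r -exprS -signr_odd -[RHS]signr_odd; congr (_ ^+ _).
rewrite /= !oddD; congr nat_of_bool.
move: nij; rewrite -val_eqE /= neq_ltn => /orP[] ij;
  rewrite ij ltnNge (ltnW ij) /=;
  by case: (odd (below C j)); case: (odd (below _ i)).
Qed.

Definition lmul_fun f g : L := f * g.
Fact lmul_is_linear f : linear (lmul_fun f).
Proof. by move=> k g h; rewrite /lmul_fun mulrDr scalerAr. Qed.
HB.instance Definition _ f :=
  GRing.isLinear.Build K L L *:%R (lmul_fun f) (lmul_is_linear f).
Definition lmul f : E := linfun (lmul_fun f).

Lemma lmulE f g : lmul f g = f * g.
Proof. by rewrite lfunE. Qed.

(* The superderivation f d_i of the Grassmann algebra. *)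
Definition fpder_fun i f : E := (lmul f \o pder i)%VF.
Fact fpder_is_linear i : linear (fpder_fun i).
Proof.
move=> k f g; apply/lfunP => h.
by rewrite /fpder_fun add_lfunE scale_lfunE !comp_lfunE !lmulE mulrDl -scalerAl.
Qed.
HB.instance Definition _ i :=
  GRing.isLinear.Build K L E *:%R (fpder_fun i) (fpder_is_linear i).
Definition fpder i : 'Hom(L, E) := linfun (fpder_fun i).

Lemma fpderE i f g : fpder i f g = f * pder i g.
Proof. by rewrite lfunE /= comp_lfunE lmulE. Qed.

(* Div (sum f_i d_i) = sum (-1) ^ p(f_i) d_i f_i, where the coefficient f_i of a
   vector field D = sum f_i d_i is D xi_i. *)
Definition divergence_fun D : L := \sum_i pder i (parity_sign (D (xi i))).
Fact divergence_is_linear : linear divergence_fun.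
Proof.
move=> k D D'; rewrite /divergence_fun scaler_sumr -big_split /=.
apply: eq_bigr => i _.
have -> : (k *: D + D') (xi i) = k *: D (xi i) + D' (xi i).
  by rewrite add_lfunE scale_lfunE.
by rewrite !linearP.
Qed.
HB.instance Definition _ :=
  GRing.isLinear.Build K E L *:%R divergence_fun divergence_is_linear.
Definition divergence : 'Hom(E, L) := linfun divergence_fun.

(* The homogeneous component of parity a of an operator, and the
   supercommutator, extended bilinearly to inhomogeneous operators. *)
Definition op_part (a : bool) D : E :=
  \sum_(b : bool) (parity_part (a (+) b) \o D \o parity_part b)%VF.

Definition sbracket D D' : E :=
  \sum_(a : bool) \sum_(b : bool)
    ((op_part a D \o op_part b D')%VF
     - (-1) ^+ (a && b) *: (op_part b D' \o op_part a D)%VF).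

Lemma op_part_linear a : linear (op_part a).
Proof.
move=> k D D'; rewrite /op_part scaler_sumr -big_split /=.
apply: eq_bigr => b _.
by rewrite comp_lfunDr comp_lfunDl -comp_lfunZr -comp_lfunZl.
Qed.

Definition rbracket D' D : E := sbracket D D'.

Fact rbracket_is_linear D' : linear (rbracket D').
Proof.
move=> k D1 D2; rewrite /rbracket /sbracket scaler_sumr -big_split /=.
apply: eq_bigr => a _; rewrite scaler_sumr -big_split /=.
apply: eq_bigr => b _; rewrite op_part_linear comp_lfunDl comp_lfunDr.
rewrite -comp_lfunZl -comp_lfunZr [in RHS]scalerBr scalerDr !scalerA mulrC opprD.
by rewrite addrACA.
Qed.

Fact sbracket_is_linear D : linear (sbracket D).
Proof.
move=> k D1 D2; rewrite /sbracket scaler_sumr -big_split /=.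
apply: eq_bigr => a _; rewrite scaler_sumr -big_split /=.
apply: eq_bigr => b _; rewrite op_part_linear comp_lfunDl comp_lfunDr.
rewrite -comp_lfunZl -comp_lfunZr [in RHS]scalerBr scalerDr !scalerA mulrC opprD.
by rewrite addrACA.
Qed.

HB.instance Definition _ D' :=
  GRing.isLinear.Build K E E *:%R (rbracket D') (rbracket_is_linear D').
HB.instance Definition _ D :=
  GRing.isLinear.Build K E E *:%R (sbracket D) (sbracket_is_linear D).

(* [U, V], the span of all brackets. *)
Definition brspan U V : {vspace E} :=
  <<[seq sbracket D D' | D <- vbasis U, D' <- vbasis V]>>%VS.

Lemma brspanP U V W :
  reflect {in U & V, forall D D', sbracket D D' \in W} (brspan U V <= W)%VS.
Proof.
apply: (iffP idP) => [sW D D' UD VD'|h].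
  rewrite (coord_vbasis UD) -/(rbracket D' _) linear_sum memv_suml // => i _.
  rewrite linearZ memvZ //= /rbracket.
  rewrite (coord_vbasis VD') linear_sum memv_suml // => j _.
  rewrite linearZ memvZ //= (subvP sW) // memv_span //.
  by apply: allpairs_f; rewrite mem_nth ?size_tuple.
apply/span_subvP => _ /allpairsP[[D D'] /= [/vbasis_mem UD /vbasis_mem VD' ->]].
exact: h.
Qed.

(* The D with [D, U] contained in W. *)
Definition bracket_into U W : {vspace E} :=
  (\bigcap_(i < \dim U) (linfun (rbracket (vbasis U)`_i) @^-1: W))%VS.

Lemma bracket_intoP U W D :
  reflect {in U, forall D', sbracket D D' \in W} (D \in bracket_into U W).
Proof.
rewrite memvE; apply: (iffP subv_bigcapP) => [h D' UD'|h i _].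
  rewrite (coord_vbasis UD') linear_sum memv_suml // => i _.
  rewrite linearZ memvZ //=; have := h i isT.
  by rewrite -memvE -memv_preim lfunE.
by rewrite -memvE -memv_preim lfunE /= h // vbasis_mem // mem_nth ?size_tuple.
Qed.

Definition is_subsuperalgebra (g s : {vspace E}) : Prop :=
  [/\ (s <= g)%VS, (forall a D, D \in s -> op_part a D \in s)
    & (brspan s s <= s)%VS].

Fixpoint derived (s : {vspace E}) (k : nat) : {vspace E} :=
  if k is k'.+1 then brspan (derived s k') (derived s k') else s.

Definition lie_solvable (s : {vspace E}) : Prop := exists k, derived s k = 0%VS.

(* A superalgebra of operators with a grading by Z, or by Z/(top_degree + 2);
   component is only used at the degrees (or representatives of degrees)
   -1, 0, ..., top_degree. *)
Record graded_vf := GradedVF {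
  carrier :> {vspace E};
  component : int -> {vspace E};
  top_degree : nat }.

Definition vect_space : {vspace E} := (\sum_i limg (fpder i))%VS.
Definition vect_deg (d : int) : {vspace E} := (\sum_i (fpder i @: homog (d + 1)%R))%VS.

Definition svect_space : {vspace E} := (vect_space :&: lker divergence)%VS.
Definition svect_deg (d : int) : {vspace E} := (vect_deg d :&: lker divergence)%VS.

Definition vect : graded_vf := GradedVF vect_space vect_deg n.-1.
Definition svect : graded_vf := GradedVF svect_space svect_deg n.-1.

Definition mulXi1_fun D : E := (lmul (1 + Xi) \o D)%VF.
Fact mulXi1_is_linear : linear mulXi1_fun.
Proof. by move=> k D D'; rewrite /mulXi1_fun comp_lfunDr -comp_lfunZr. Qed.
HB.instance Definition _ :=
  GRing.isLinear.Build K E E *:%R mulXi1_fun mulXi1_is_linear.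
Definition mulXi1 : 'Hom(E, E) := linfun mulXi1_fun.

(* (1 + Xi) svect(0|n), a subsuperalgebra of vect(0|n) for even n only. Its
   degrees are modulo n, with representatives -1, 0, ..., n - 2. *)
Definition tsvect_deg (d : int) : {vspace E} :=
  if d == -1 then <<[seq fpder i (1 + Xi)%R | i : 'I_n]>>%VS else svect_deg d.
Definition tsvect : graded_vf :=
  GradedVF (mulXi1 @: svect_space) tsvect_deg n.-2.

Section Graded.
Variable g : graded_vf.

(* The components of degrees -1, 0, ..., top_degree are independent, so the sum
   below is direct. *)
Definition is_graded (s : {vspace E}) : Prop :=
  s = (\sum_(j < (top_degree g).+2) (s :&: component g (j%:Z - 1)))%VS.

Definition graded_solvable (s : {vspace E}) : Prop :=
  [/\ is_subsuperalgebra g s, is_graded s & lie_solvable s].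

Definition maximal_solvable (s : {vspace E}) : Prop :=
  graded_solvable s /\
  forall t : {vspace E}, graded_solvable t -> (s <= t)%VS -> t = s.

Definition solvable_preserving (sm1 s0 : {vspace E}) : Prop :=
  [/\ is_subsuperalgebra (component g 0) s0, lie_solvable s0 & (brspan s0 sm1 <= sm1)%VS].

Definition maximal_solvable_preserving (sm1 s0 : {vspace E}) : Prop :=
  solvable_preserving sm1 s0 /\
  forall t : {vspace E}, solvable_preserving sm1 t -> (s0 <= t)%VS -> t = s0.

(* The components of degrees k >= 0; the one of degree -1 is sm1 itself. *)
Fixpoint prolong_comp (sm1 s0 : {vspace E}) (k : nat) : {vspace E} :=
  if k is k'.+1 then
    (component g k :&: bracket_into sm1 (prolong_comp sm1 s0 k'))%VS
  else s0.

Definition prolong (sm1 s0 : {vspace E}) : {vspace E} :=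
  (sm1 + \sum_(k < (top_degree g).+1) prolong_comp sm1 s0 k)%VS.

End Graded.

End VectorFields.

Arguments vect : clear implicits.
Arguments svect : clear implicits.
Arguments tsvect : clear implicits.

(* Main.v *)
From HB Require Import structures.
Require Import Defs.
From mathcomp Require Import all_boot all_order all_algebra.
From mathcomp Require Import reals complex.
From mathcomp Require Import ring zify.
Import Order.TTheory GRing.Theory Num.Theory.
Local Open Scope ring_scope.

(** The components of degree -1 of the three families are the constant fields,
    V, or their images under multiplication by 1 + Xi, and the components of
    degree 0 are gl(V) or sl(V).  Write W for s_(-1), viewed inside V.

    What maximality gives.  If U is a subspace with W <= U <= W + Cv that s_0
    preserves, the fields of degree 0 that kill W, preserve U and act on V / U by
    a scalar form a solvable ideal normalised by s_0, which also preserves W; so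
    s_0 contains it ([ideal_sub_max]).  For U = W this puts the nilradical
    Hom(V / W, W) of the parabolic subalgebra of W in s_0 ([nilradical_sub]).

    The prolong is solvable.  It is closed under the bracket by the Jacobi
    identity.  The components of degrees -1 and 0 of its derived series are bounded
    by U and T, where U is replaced by [T, U] and T by [T, T] + [U, s_1] at each
    step, and this process becomes stationary.  Then, by Lie's theorem, U has a
    T-stable hyperplane A unless it is 0, and T acts on U / A by a character; this
    character vanishes on [T, T], and also on [U, s_1], because [[u, D], v] is
    antisymmetric in the constant fields u and v.  Hence U = [T, U] <= A, a
    contradiction ([perfect_module_eq0]).  So U = 0, then T = [T, T] is 0, and the
    part of positive degree is nilpotent ([prolong_solvable]).

    The prolong is maximal.  Let t be a graded solvable algebra that contains it.
    - t_0 preserves W: if x in t_0 moved w in W out of W, the commutator of x with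
      a suitable element of the nilradical would fix w, whereas commutators of a
      solvable algebra are nilpotent.  So t_0 = s_0 ([solvable_above_max]).
    - t_(-1) = W: from a v outside W, brackets with well chosen elements of s_1
      would produce in t_0 = s_0 two rank one maps whose commutator is not
      nilpotent if dim W > 1 ([const_line_case]), or a map that moves W if W is a
      line ([line_case]; this is where n > 2 enters).
    - For k > 0, t_k is in s_k by induction, since [t_k, W] is in t_(k-1)
      ([graded_above]).

    For (1 + Xi) svect, multiplication by 1 + Xi carries the constant fields to the
    component of degree -1 and changes no bracket with positive degrees.  The one
    new bracket, of two elements of degree -1, has degree n - 2 and falls into the
    prolong because Xi is divisible by a linear form that vanishes on W
    ([deformed_sbracket]).  For the same reason Xi W lies in the prolong taken in
    vect, whose solvability therefore suffices. *)

Set Implicit Arguments.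
Unset Strict Implicit.
Unset Printing Implicit Defensive.

(** * The Grassmann algebra *)

Section Functional.
Variables (K : fieldType) (M : vectType K).
Implicit Types (A : {vspace M}) (u v : M).

Lemma exists_functional A v : v \notin A ->
  exists phi : 'Hom(M, K^o), {in A, forall u, phi u = 0} /\ phi v = 1.
Proof.
move=> nvA; pose q : 'End(M) := (\1 - projv A)%VF.
have qA u : u \in A -> q u = 0.
  by move=> uA; rewrite add_lfunE opp_lfunE id_lfunE projv_id ?subrr.
have qv : q v != 0.
  rewrite add_lfunE opp_lfunE id_lfunE subr_eq0; apply: contra nvA => /eqP->.
  exact: memv_proj.
have fr : free [:: q v] by rewrite seq1_free.
exists (linfun (coord [tuple q v] ord0 : M -> K^o) \o q)%VF; split=> [u uA|].
  by rewrite comp_lfunE (qA _ uA); apply: linear0.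
rewrite comp_lfunE lfunE /= (_ : q v = [tuple q v]`_(@ord0 0)) //.
by rewrite coord_free // eqxx.
Qed.

End Functional.

Section Grassmann.
Variables (K : fieldType) (n : nat).
Local Notation L := (grassmann K n).
Local Notation E := 'End(L).
Local Notation xi := (@xi K n).
Local Notation sigma := (@parity_sign K n).
Local Notation part := (@parity_part K n).
Local Notation pder := (@pder K n).
Local Notation fpder := (@fpder K n).
Implicit Types (A B C : {set 'I_n}) (i j : 'I_n) (f g h : L) (D : E) (a b c : bool).

Lemma grass_ext f g : (forall C, f C = g C :> K) -> f = g.
Proof. by move=> h; apply/ffunP. Qed.

Lemma gaddE f g C : (f + g) C = f C + g C :> K.
Proof. by rewrite ffunE. Qed.
Lemma goppE f C : (- f) C = - f C :> K.
Proof. by rewrite ffunE. Qed.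
Lemma gscaleE k f C : (k *: f) C = k * f C :> K.
Proof. by rewrite ffunE. Qed.
Lemma g0E C : (0 : L) C = 0 :> K.
Proof. by rewrite ffunE. Qed.
Lemma monoE A C : @mono K n A C = (C == A)%:R :> K.
Proof. by rewrite ffunE. Qed.

Lemma partE b f C : part b f C = (if odd #|C| == b then f C else 0) :> K.
Proof. by rewrite lfunE ffunE. Qed.

Lemma grass_coord f : f = \sum_A (f A : K) *: @mono K n A.
Proof.
apply: grass_ext => C; rewrite sum_ffunE (bigD1 C) //= gscaleE monoE eqxx mulr1.
rewrite big1 ?addr0 // => A nA.
by rewrite gscaleE monoE eq_sym (negPf nA) mulr0.
Qed.

Lemma mono_set0 : @mono K n set0 = 1.
Proof. by apply: grass_ext => C; rewrite !ffunE. Qed.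

Lemma mono_xi j A : j \in A -> @mono K n A = (-1) ^+ below A j *: (xi j * mono K (A :\ j)).
Proof.
move=> jA; apply: grass_ext => C; rewrite gscaleE xi_mulE !monoE.
have [->|nCA] := eqVneq C A.
  by rewrite jA eqxx mulr1 -exprD addnn -mul2n exprM sqrrN !expr1n.
case: ifP => jC; last by rewrite mulr0.
rewrite (_ : (_ == _) = false) ?mulr0 //; apply: contraNF nCA => /eqP e.
by rewrite -(setD1K jC) e setD1K.
Qed.

(** Induction over the presentation by generators: the monomials are obtained
    from 1 by left multiplication by the generators. *)
Lemma grass_ind (P : L -> Prop) :
  (forall k f g, P f -> P g -> P (k *: f + g)) -> P 1 ->
  (forall j f, P f -> P (xi j * f)) -> forall f, P f.
Proof.
move=> Plin P1 Pxi f.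
have P0 : P 0 by have := Plin (-1) _ _ P1 P1; rewrite scaleN1r addNr.
have Pm A : P (mono K A).
  elim: {A}_.+1 {-2}A (ltnSn #|A|) => // m IH A.
  have [->|[j jA]] := set_0Vmem A; first by rewrite mono_set0.
  rewrite ltnS => cA; rewrite (mono_xi jA) -[_ *: _]addr0.
  apply: (Plin) => //; apply: Pxi; apply: IH.
  by move: cA; rewrite (cardsD1 j A) jA.
rewrite (grass_coord f); elim/big_rec: _ => // A g _ Pg.
exact: Plin.
Qed.

Lemma xi_swap i j f : xi i * (xi j * f) = - (xi j * (xi i * f)).
Proof.
apply: grass_ext => C; rewrite goppE !xi_mulE !inE.
have [->|nij] := eqVneq i j; first by rewrite ?eqxx /= mulr0 if_same oppr0.
rewrite ?(negPf nij) ?[j == i]eq_sym ?(negPf nij) /=.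
case iC : (i \in C); case jC : (j \in C); rewrite /= ?mulr0 ?oppr0 //.
rewrite (belowD1 i jC) (belowD1 j iC) !mulrA -!exprD.
have -> : C :\ j :\ i = C :\ i :\ j by rewrite !setDDl setUC.
rewrite -mulNr; congr (_ * _).
rewrite -[RHS]mulN1r -exprS -signr_odd -[RHS]signr_odd; congr (_ ^+ _).
rewrite /= !oddD; congr nat_of_bool.
move: nij; rewrite -val_eqE /= neq_ltn => /orP[] ij;
  rewrite ij ltnNge (ltnW ij) /=;
  by case: (odd (below _ i)); case: (odd (below _ j)).
Qed.

Lemma partK b f : part b (part b f) = part b f.
Proof. by apply: grass_ext => C; rewrite !partE; case: eqP. Qed.

Lemma partN b f : part (~~ b) (part b f) = 0.
Proof. by apply: grass_ext => C; rewrite !partE g0E; case: eqP => // ->; case: b. Qed.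

Lemma part_sum f : f = part false f + part true f.
Proof.
by apply: grass_ext => C; rewrite gaddE !partE; case: (odd _); rewrite ?addr0 ?add0r.
Qed.

Lemma sigmaE f C : sigma f C = (-1) ^+ odd #|C| * f C :> K.
Proof.
rewrite /parity_sign add_lfunE opp_lfunE gaddE goppE !partE.
by case: (odd _); rewrite /= ?mulN1r ?mul1r ?subr0 ?sub0r.
Qed.

Lemma sigmaK f : sigma (sigma f) = f.
Proof.
by apply: grass_ext => C; rewrite !sigmaE mulrA -expr2 -exprM mulnC exprM sqrrN !expr1n mul1r.
Qed.

Lemma part_xi b j f : part b (xi j * f) = xi j * part (~~ b) f.
Proof.
apply: grass_ext => C; rewrite partE !xi_mulE partE.
case jC : (j \in C); last by rewrite if_same.
by rewrite (cardsD1 j C) jC /=; case: (odd _); case: b; rewrite /= ?mulr0.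
Qed.

End Grassmann.

(** * Parity and the super Jacobi identity *)

Section Parity.
Variables (K : fieldType) (n : nat).
Local Notation L := (grassmann K n).
Local Notation E := 'End(L).
Local Notation xi := (@xi K n).
Local Notation sigma := (@parity_sign K n).
Local Notation part := (@parity_part K n).
Local Notation pder := (@pder K n).
Local Notation fpder := (@fpder K n).
Implicit Types (A B C : {set 'I_n}) (i j : 'I_n) (f g h : L) (D : E) (a b c : bool).

Lemma sigma_xi j f : sigma (xi j * f) = - (xi j * sigma f).
Proof.
rewrite /parity_sign !add_lfunE !opp_lfunE !part_xi /= mulrBr opprB.
by rewrite addrC.
Qed.

Lemma sigma1 : sigma 1 = 1.
Proof.
apply: grass_ext => C; rewrite sigmaE -mono_set0 monoE.
by case: eqP => [->|]; rewrite ?cards0 ?mul1r ?mulr0.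
Qed.

Lemma sigmaM f g : sigma (f * g) = sigma f * sigma g.
Proof.
elim/grass_ind: f => [k f1 f2 IH1 IH2||j f IH].
- by rewrite mulrDl -scalerAl !linearP /= IH1 IH2 mulrDl -scalerAl.
- by rewrite sigma1 !mul1r.
by rewrite -mulrA !sigma_xi IH mulNr mulrA.
Qed.

Definition sigma_pow a f : L := if a then sigma f else f.

Lemma sigma_pow_is_linear a : linear (sigma_pow a).
Proof. by case: a => // k f g; rewrite /sigma_pow linearP. Qed.
HB.instance Definition _ a :=
  GRing.isLinear.Build K L L *:%R (sigma_pow a) (sigma_pow_is_linear a).

Lemma sigma_pow_comp a b f : sigma_pow a (sigma_pow b f) = sigma_pow (a (+) b) f.
Proof. by case: a; case: b; rewrite //= sigmaK. Qed.

Lemma sigma_part b f : sigma (part b f) = (-1) ^+ b *: part b f.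
Proof.
apply: grass_ext => C; rewrite sigmaE gscaleE partE.
by case: (odd _); case: b; rewrite /= ?mulr0.
Qed.

Lemma xi_mulC j g : xi j * g = sigma g * xi j.
Proof.
elim/grass_ind: g => [k f1 f2 IH1 IH2||i f IH].
- by rewrite mulrDr -scalerAr linearP /= IH1 IH2 mulrDl -scalerAl.
- by rewrite sigma1 mul1r mulr1.
by rewrite xi_swap sigma_xi IH mulNr mulrA.
Qed.

Lemma supercomm b f g : part b f * g = sigma_pow b g * part b f.
Proof.
elim/grass_ind: f b => [k f1 f2 IH1 IH2||j f IH] b.
- by rewrite linearP /= mulrDl mulrDr -scalerAl -scalerAr IH1 IH2.
- have p1 : part b 1 = (~~ b)%:R.
    have -> : (~~ b)%:R = (~~ b)%:R *: (1 : L) by rewrite scaler_nat.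
    apply: grass_ext => C; rewrite gscaleE partE -mono_set0 monoE.
    by have [->|_] := eqVneq C set0; rewrite ?cards0 ?mulr0 ?if_same //; case: b; rewrite /= ?mul0r ?mul1r.
  by rewrite p1; case: b {p1}; rewrite ?(mul0r, mulr0, mul1r, mulr1).
rewrite part_xi -mulrA IH [LHS]mulrA [in LHS]xi_mulC [RHS]mulrA.
by rewrite -[sigma (sigma_pow _ _)]/(sigma_pow true _) sigma_pow_comp addTb negbK.
Qed.

Definition has_parity a D := forall b f, D (part b f) = part (a (+) b) (D f).

Lemma op_part_id a D : has_parity a D -> op_part a D = D.
Proof.
move=> pD; apply/lfunP => f; rewrite /op_part sum_lfunE big_bool /= !comp_lfunE !pD !partK.
by rewrite [RHS]part_sum; case: a {pD}; rewrite //= addrC.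
Qed.

Lemma op_part0 a D : has_parity a D -> op_part (~~ a) D = 0.
Proof.
move=> pD; apply/lfunP => f; rewrite /op_part sum_lfunE big_bool /= !comp_lfunE !pD.
by rewrite !addNb !partN zero_lfunE addr0.
Qed.

Lemma sbracketE a b D D' f : has_parity a D -> has_parity b D' ->
  sbracket D D' f = D (D' f) - (-1) ^+ (a && b) *: D' (D f).
Proof.
move=> pD pD'; have [qD qD'] := (op_part0 pD, op_part0 pD').
have [rD rD'] := (op_part_id pD, op_part_id pD').
have z (x y : E) s : x = 0 \/ y = 0 -> (x \o y - s *: (y \o x))%VF = 0.
  by case=> ->; rewrite comp_lfun0r comp_lfun0l scaler0 subrr.
rewrite /sbracket (bigD1 a) //= [X in _ + X]big1 ?addr0 => [|a' na]; last first.
  rewrite big1 // => b' _; apply: z; left.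
  by have -> : a' = ~~ a by move: na; case: (a'); case: (a).
rewrite (bigD1 b) //= [X in _ + X]big1 ?addr0 => [|b' nb]; last first.
  by apply: z; right; have -> : b' = ~~ b by move: nb; case: (b'); case: (b).
by rewrite rD rD' add_lfunE opp_lfunE scale_lfunE !comp_lfunE.
Qed.

Lemma has_parity_sbracket a b D D' : has_parity a D -> has_parity b D' ->
  has_parity (a (+) b) (sbracket D D').
Proof.
move=> pD pD' c f; rewrite !(sbracketE _ pD pD') !pD pD' pD linearB linearZ /=.
by rewrite pD' !addbA [b (+) a]addbC linearZ scalerN.
Qed.

Lemma has_parity_sigma a D f : has_parity a D -> D (sigma f) = (-1) ^+ a *: sigma (D f).
Proof.
move=> pD; rewrite /parity_sign !add_lfunE !opp_lfunE linearB /= !pD.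
by case: a {pD}; rewrite ?scale1r //= scaleN1r opprB.
Qed.

Lemma has_parity_sigma_pow a b D f : has_parity a D ->
  D (sigma_pow b f) = (-1) ^+ (a && b) *: sigma_pow b (D f).
Proof.
by move=> pD; case: b; rewrite /= ?andbF ?andbT ?scale1r // (has_parity_sigma _ pD).
Qed.

Lemma sbracketC a b D D' : has_parity a D -> has_parity b D' ->
  sbracket D D' = - (-1) ^+ (a && b) *: sbracket D' D.
Proof.
move=> pD pD'; apply/lfunP => f; rewrite scale_lfunE (sbracketE _ pD pD') (sbracketE _ pD' pD).
rewrite scalerBr scalerA mulNr [b && a]andbC -expr2 -exprM mulnC exprM sqrrN !expr1n.
by rewrite scaleNr scaleN1r opprK addrC.
Qed.

(** Only the expansions of the six brackets matter, so they are abstracted here. *)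
Lemma jacobi_signs a b c D D' D'' (B12 B23 B13 L R1 R2 : E) :
  (forall f, B12 f = D (D' f) - (-1) ^+ (a && b) *: D' (D f)) ->
  (forall f, B23 f = D' (D'' f) - (-1) ^+ (b && c) *: D'' (D' f)) ->
  (forall f, B13 f = D (D'' f) - (-1) ^+ (a && c) *: D'' (D f)) ->
  (forall f, L f = B12 (D'' f) - (-1) ^+ ((a (+) b) && c) *: D'' (B12 f)) ->
  (forall f, R1 f = D (B23 f) - (-1) ^+ (a && (b (+) c)) *: B23 (D f)) ->
  (forall f, R2 f = B13 (D' f) - (-1) ^+ ((a (+) c) && b) *: D' (B13 f)) ->
  L = R1 + (-1) ^+ (b && c) *: R2.
Proof.
move=> e12 e23 e13 eL eR1 eR2; apply/lfunP => f; rewrite add_lfunE scale_lfunE.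
rewrite eL eR1 eR2 !e12 !e23 !e13 !(linearB D) !(linearB D') !(linearB D'') /=.
rewrite !linearZ /=.
apply: grass_ext => C; rewrite !(gaddE, goppE, gscaleE).
by case: a {e12 e13 eL eR1 eR2}; case: b {e23}; case: c; rewrite /= ?expr1 ?expr0; ring.
Qed.

Lemma jacobi a b c D D' D'' :
    has_parity a D -> has_parity b D' -> has_parity c D'' ->
  sbracket (sbracket D D') D'' =
    sbracket D (sbracket D' D'') + (-1) ^+ (b && c) *: sbracket (sbracket D D'') D'.
Proof.
move=> p p' p''; apply: jacobi_signs.
- by move=> f; exact: sbracketE p p'.
- by move=> f; exact: sbracketE p' p''.
- by move=> f; exact: sbracketE p p''.
- by move=> f; exact: sbracketE (has_parity_sbracket p p') p''.
- by move=> f; exact: sbracketE p (has_parity_sbracket p' p'').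
- by move=> f; exact: sbracketE (has_parity_sbracket p p'') p'.
Qed.
End Parity.

(** * Superderivations *)

Section Superderivations.
Variables (K : fieldType) (n : nat).
Local Notation L := (grassmann K n).
Local Notation E := 'End(L).
Local Notation xi := (@xi K n).
Local Notation sigma := (@parity_sign K n).
Local Notation part := (@parity_part K n).
Local Notation pder := (@pder K n).
Local Notation fpder := (@fpder K n).
Implicit Types (A B C : {set 'I_n}) (i j : 'I_n) (f g h : L) (D : E) (a b c : bool).

Definition superder a D :=
  has_parity a D /\ forall f g, D (f * g) = D f * g + sigma_pow a f * D g.

Lemma superder1 a D : superder a D -> D 1 = 0.
Proof.
case=> _ /(_ 1 1); rewrite !mulr1 (_ : sigma_pow a 1 = 1) ?mul1r.
  by move/eqP; rewrite eq_sym -subr_eq0 addrK => /eqP.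
by case: a; rewrite //= sigma1.
Qed.

Lemma superder_ext a D D' : superder a D -> superder a D' ->
  (forall i, D (xi i) = D' (xi i)) -> D = D'.
Proof.
move=> sD sD' e; apply/lfunP; elim/grass_ind => [k f g IH IH'||j f IH].
- by rewrite !linearP /= IH IH'.
- by rewrite (superder1 sD) (superder1 sD').
by rewrite sD.2 sD'.2 e IH.
Qed.

Lemma superder_sbracket a b D D' : superder a D -> superder b D' ->
  superder (a (+) b) (sbracket D D').
Proof.
move=> [pD lD] [pD' lD']; split; first exact: has_parity_sbracket.
move=> f g; have e := sbracketE _ pD pD'; rewrite !e.
rewrite lD' lD !linearD /= !(lD, lD') (has_parity_sigma_pow _ _ pD) (has_parity_sigma_pow _ _ pD').
rewrite !sigma_pow_comp [b (+) a]addbC.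
rewrite !mulrBl !mulrBr -!scalerAl -!scalerAr !scalerDr !scalerA.
rewrite [b && a]andbC -expr2 -exprM mulnC exprM sqrrN !expr1n scale1r.
apply: grass_ext => C; rewrite !(gaddE, goppE, gscaleE).
set s := (-1) ^+ _; ring.
Qed.

Lemma pder_has_parity i : has_parity true (pder i).
Proof.
move=> b f; apply: grass_ext => C; rewrite !(pderE, partE).
case iC: (i \in C); rewrite ?if_same // cardsU1 iC /=.
by case: (odd _); case: b; rewrite /= ?mulr0.
Qed.

Lemma pder_superder i : superder true (pder i).
Proof.
split=> [|f g]; first exact: pder_has_parity.
rewrite /=; elim/grass_ind: f => [k f1 f2 IH1 IH2||j f IH].
- rewrite mulrDl -scalerAl !linearD !linearZ /= IH1 IH2 !mulrDl -!scalerAl.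
  by rewrite scalerDr addrACA.
- by rewrite pder1 sigma1 mul0r mul1r mul1r add0r.
rewrite -mulrA !pder_xiM IH sigma_xi mulrBl mulNr mulrDr opprD -!mulrA addrA.
by rewrite mulrnAl.
Qed.

Lemma part1 b : part b 1 = (~~ b)%:R *: 1.
Proof.
apply: grass_ext => C; rewrite gscaleE partE -mono_set0 monoE.
by have [->|_] := eqVneq C set0; rewrite ?cards0 ?mulr0 ?if_same //; case: b; rewrite /= ?mul0r ?mul1r.
Qed.

Lemma partM b c f g : part (b (+) c) (part b f * g) = part b f * part c g.
Proof.
elim/grass_ind: f b => [k f1 f2 IH1 IH2||j f IH] b.
- by rewrite linearP /= !mulrDl -!scalerAl linearP /= IH1 IH2.
- by rewrite part1 -!scalerAl !mul1r linearZ /=; case: b; rewrite ?scale0r //= addFb.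
by rewrite part_xi -!mulrA part_xi -addNb IH.
Qed.

Lemma superder_fpder i b f : part b f = f -> superder (~~ b) (fpder i f).
Proof.
move=> pf; have [pi li] := pder_superder i; split=> [c g|g h].
  by rewrite !fpderE pi -pf -partM addNb -addbN.
rewrite !fpderE li mulrDr !mulrA; congr (_ + _ * _).
by rewrite -pf supercomm /= -[sigma g]/(sigma_pow true g) sigma_pow_comp addbT.
Qed.

Local Notation H p := (homog K n p%:Z).

Lemma homogP p f : reflect (forall C, #|C| <> p -> f C = 0 :> K) (f \in H p).
Proof.
apply: (iffP idP) => [/memv_sumP[fs hfs ->] C nC|h].
  rewrite sum_ffunE big1 // => A cA; have /vlineP[k ->] := hfs A cA.
  rewrite gscaleE monoE (_ : _ == _ = false) ?mulr0 //.
  by apply/eqP => eCA; apply: nC; rewrite eCA; move: cA => /eqP[].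
rewrite (grass_coord f) memv_suml // => A _.
have [e|ne] := eqVneq #|A| p; last by rewrite h ?scale0r ?mem0v //; apply/eqP.
by rewrite memvZ // memvE; apply: (sumv_sup A) => //; rewrite e.
Qed.

Lemma homog_part p f : f \in H p -> part (odd p) f = f.
Proof.
move=> /homogP h; apply: grass_ext => C; rewrite partE; case: eqP => // ne.
by rewrite h // => e; apply: ne; rewrite e.
Qed.

Lemma homogM p q f g : f \in H p -> g \in H q -> f * g \in H (p + q)%N.
Proof.
move=> /homogP hf /homogP hg; apply/homogP => C nC.
rewrite ffunE big1 // => A sAC.
have [eA|/eqP nA] := eqVneq #|A| p; last by rewrite hf // mul0r mulr0.
rewrite hg ?mulr0 // => eB; apply: nC.
by rewrite -eA -eB cardsDS // subnKC // subset_leq_card.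
Qed.

Lemma homog_pder p i f : f \in H p -> pder i f \in H p.-1.
Proof.
move=> /homogP h; apply/homogP => C nC; rewrite pderE; case: ifP => // iC.
by rewrite h ?mulr0 // cardsU1 iC; move: nC; case: p {h} => //= p nC [].
Qed.

Lemma homog_pder0 i f : f \in H 0 -> pder i f = 0.
Proof.
move=> /homogP h; apply: grass_ext => C; rewrite pderE g0E; case: ifP => // iC.
by rewrite h ?mulr0 // cardsU1 iC.
Qed.

Lemma homog0 f : f \in H 0 -> f = (f set0 : K) *: 1.
Proof.
move=> /homogP h; apply: grass_ext => C; rewrite gscaleE -mono_set0 monoE.
have [->|nC] := eqVneq C set0; first by rewrite mulr1.
by rewrite mulr0 h // => /eqP; rewrite cards_eq0 (negPf nC).
Qed.

Lemma homog1 : (1 : L) \in H 0.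
Proof.
apply/homogP => C nC; rewrite -mono_set0 monoE; case: eqP nC => // ->.
by rewrite cards0.
Qed.

Lemma homog_xi i : xi i \in H 1.
Proof.
by apply/homogP => C nC; rewrite monoE; case: eqP nC => // ->; rewrite cards1.
Qed.

Lemma homog_big p f : (n < p)%N -> f \in H p -> f = 0.
Proof.
move=> np /homogP h; apply: grass_ext => C; rewrite g0E h // => e.
by have := max_card C; rewrite card_ord e leqNgt np.
Qed.

(** Each monomial with a nonempty index set survives some derivative. *)
Lemma homog_pder_eq0 p f : f \in H p.+1 -> (forall i, pder i f = 0) -> f = 0.
Proof.
move=> /homogP h d0; apply: grass_ext => C; rewrite g0E.
have [->|[i iC]] := set_0Vmem C; first by rewrite h // cards0.
have /ffunP/(_ (C :\ i)) := d0 i; rewrite pderE g0E !inE eqxx /= setD1K // => /eqP.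
by rewrite mulf_eq0 signr_eq0 => /eqP.
Qed.

Local Notation X p := (vect_deg K n (p%:Z - 1)).

Lemma fpder_xi i j f : fpder i f (xi j) = f *+ (i == j).
Proof.
by rewrite fpderE -[xi j]mulr1 pder_xiM pder1 mulr0 subr0 mulrnAr mulr1.
Qed.

Lemma superder_sum p (fs : 'I_n -> L) : (forall i, fs i \in H p) ->
  superder (~~ odd p) (\sum_i fpder i (fs i)).
Proof.
move=> hf; split=> [b f|f g]; rewrite !sum_lfunE.
  rewrite linear_sum; apply: eq_bigr => i _.
  exact: (superder_fpder _ (homog_part (hf i))).1.
rewrite mulr_suml mulr_sumr -big_split; apply: eq_bigr => i _ /=.
exact: (superder_fpder _ (homog_part (hf i))).2.
Qed.

Lemma sum_fpder_xi (fs : 'I_n -> L) j : (\sum_i fpder i (fs i)) (xi j) = fs j.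
Proof.
rewrite sum_lfunE (bigD1 j) //= big1 ?addr0 => [|i nij].
  by rewrite fpder_xi eqxx.
by rewrite fpder_xi (negPf nij).
Qed.

(** A superderivation is determined by its values on the generators, and these can
    be prescribed. *)
Lemma vect_degP p D :
  D \in X p <-> superder (~~ odd p) D /\ forall i, D (xi i) \in H p.
Proof.
rewrite /vect_deg subrK; split=> [/memv_sumP[Ds hDs ->]|[sD hD]].
  have /(_ _ isT) := hDs; have exf i : {f | f \in H p & Ds i = fpder i f}.
    have /memv_imgP/sig2_eqW[f fH ->] := hDs i isT; first by exists f.
  pose fs i := s2val (exf i).
  have hfs i : fs i \in H p by rewrite /fs; case: (exf i).
  rewrite (eq_bigr (fun i => fpder i (fs i))) => [_|i _]; last first.
    by rewrite /fs; case: (exf i).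
  by split=> [|i]; [apply: superder_sum | rewrite sum_fpder_xi].
have -> : D = \sum_i fpder i (D (xi i)).
  apply: (superder_ext sD (superder_sum hD)) => i; by rewrite sum_fpder_xi.
by apply: memv_sumr => i _; apply: memv_img.
Qed.

Lemma vect_deg_ext p D D' : D \in X p -> D' \in X p ->
  (forall i, D (xi i) = D' (xi i)) -> D = D'.
Proof. by move=> /vect_degP[s _] /vect_degP[s' _]; apply: superder_ext s s'. Qed.

Lemma vect_deg_expand p D : D \in X p -> D = \sum_i fpder i (D (xi i)).
Proof.
move=> /vect_degP[sD hD]; apply: (superder_ext sD (superder_sum hD)) => i.
by rewrite sum_fpder_xi.
Qed.

Lemma vect_deg_homog p q D f : D \in X p -> f \in H q -> D f \in H (p + q).-1.
Proof.
move=> DX fH; rewrite (vect_deg_expand DX) sum_lfunE; apply: memv_suml => i _.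
rewrite fpderE; case: q fH => [|q] fH; first by rewrite homog_pder0 // mulr0 mem0v.
by rewrite addnS; apply: homogM; [have /vect_degP[] := DX | apply: homog_pder fH].
Qed.

Lemma vect_deg_const p D f : D \in X p -> f \in H 0 -> D f = 0.
Proof.
by move=> /vect_degP[sD _] /homog0->; rewrite linearZ /= (superder1 sD) scaler0.
Qed.

Lemma vect_deg_parity p D : D \in X p -> has_parity (~~ odd p) D.
Proof. by move=> /vect_degP[[]]. Qed.

Lemma vect_degE p q D D' f : D \in X p -> D' \in X q ->
  sbracket D D' f = D (D' f) - (-1) ^+ (~~ odd p && ~~ odd q) *: D' (D f).
Proof. by move=> /vect_deg_parity a /vect_deg_parity b; apply: sbracketE. Qed.

Lemma vect_deg_sbracket p q D D' : D \in X p -> D' \in X q ->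
  sbracket D D' \in X (p + q).-1.
Proof.
move=> DX DX'; have /vect_degP[sD hD] := DX; have /vect_degP[sD' hD'] := DX'.
have h i : sbracket D D' (xi i) \in H (p + q).-1.
  rewrite (vect_degE _ DX DX') memvB ?memvZ //; first exact: vect_deg_homog.
  by rewrite addnC; apply: vect_deg_homog.
have s := superder_sbracket sD sD'.
case: p q DX DX' sD sD' hD hD' h s => [|p] [|q] DX DX' sD sD' hD hD' h s; last first.
- apply/vect_degP; split=> //; move: s; congr (superder _ _).
  by rewrite addSn addnS /= oddD; case: (odd p); case: (odd q).
- apply/vect_degP; split=> //; move: s; congr (superder _ _).
  by rewrite addn0 /=; case: (odd p).
- by apply/vect_degP; split=> //; move: s; congr (superder _ _); rewrite /=; case: (odd q).
rewrite (_ : sbracket D D' = 0) ?mem0v //; apply: (superder_ext s).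
  by split=> [b f|f g]; rewrite !zero_lfunE ?linear0 // mul0r mulr0 addr0.
move=> i; rewrite zero_lfunE (vect_degE _ DX DX').
by rewrite (vect_deg_const DX) // (vect_deg_const DX') // scaler0 subr0.
Qed.

Lemma vect_deg_big p D : (n < p)%N -> D \in X p -> D = 0.
Proof.
move=> np DX; rewrite (vect_deg_expand DX) big1 // => i _.
by have -> : D (xi i) = 0; rewrite ?linear0 //; apply: (homog_big np); have /vect_degP[] := DX.
Qed.
End Superderivations.

(** * Constant fields, the Euler field and the divergence *)

Section ConstantFields.
Variables (K : fieldType) (n : nat).
Local Notation L := (grassmann K n).
Local Notation E := 'End(L).
Local Notation xi := (@xi K n).
Local Notation Xi := (Xi K n).
Local Notation sigma := (@parity_sign K n).
Local Notation part := (@parity_part K n).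
Local Notation pder := (@pder K n).
Local Notation fpder := (@fpder K n).
Local Notation divergence := (@divergence K n).
Local Notation H p := (homog K n p%:Z).
Local Notation X p := (vect_deg K n (p%:Z - 1)).
Implicit Types (A B C : {set 'I_n}) (i j : 'I_n) (f g h : L) (D u v w : E) (a b c : bool).

Lemma pderX i : pder i \in X 0.
Proof.
apply/vect_degP; split=> [|j]; first exact: pder_superder.
by rewrite -[xi j]mulr1 pder_xiM pder1 mulr0 subr0 rpredMn ?homog1.
Qed.

Lemma const_expand u : u \in X 0 -> u = \sum_i (u (xi i) set0 : K) *: pder i.
Proof.
move=> uX; rewrite {1}(vect_deg_expand uX); apply: eq_bigr => i _.
have /vect_degP[_ /(_ i) /homog0 e] := uX; rewrite {1}e linearZ /=; congr (_ *: _).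
by apply/lfunP => f; rewrite fpderE mul1r.
Qed.

Lemma const_sbracket u v : u \in X 0 -> v \in X 0 -> sbracket u v = 0.
Proof.
move=> uX vX; apply: (@vect_deg_ext _ _ 0); rewrite ?mem0v //.
  exact: vect_deg_sbracket uX vX.
move=> i; rewrite zero_lfunE (vect_degE _ uX vX).
have /vect_degP[_ /(_ i) hu] := uX; have /vect_degP[_ /(_ i) hv] := vX.
by rewrite (vect_deg_const uX) // (vect_deg_const vX) // scaler0 subr0.
Qed.

Lemma const_anticomm u v f : u \in X 0 -> v \in X 0 -> u (v f) = - v (u f).
Proof.
move=> uX vX; have := congr1 (fun D : E => D f) (const_sbracket uX vX).
by rewrite /= (vect_degE _ uX vX) zero_lfunE expr1 scaleN1r opprK => /eqP; rewrite addr_eq0 => /eqP.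
Qed.

Lemma const_eval u f : u \in X 0 -> f \in H 1 -> u f = (u f set0 : K) *: 1.
Proof. by move=> uX fH; apply: homog0; have := vect_deg_homog uX fH. Qed.

Lemma const_mul u f g : u \in X 0 -> u (f * g) = u f * g + sigma f * u g.
Proof. by move=> /vect_degP[[_ ->]]. Qed.

Lemma homog_sigma p f : f \in H p -> sigma f = (-1) ^+ p *: f.
Proof. by move=> fH; rewrite -(homog_part fH) sigma_part signr_odd. Qed.

(** The elements of degree 1 are the linear forms on the constant fields. *)
Lemma exists_form (A : {vspace E}) v :
  (A <= X 0)%VS -> v \in X 0 -> v \notin A ->
  exists xi0, [/\ xi0 \in H 1, {in A, forall u, u xi0 = 0} & v xi0 = 1].
Proof.
move=> sA vX nvA.
have [phi [phiA phiv]] := exists_functional nvA.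
exists (\sum_i (phi (pder i) : K) *: xi i).
have ev u : u \in X 0 -> u (\sum_i (phi (pder i) : K) *: xi i) = (phi u : K) *: 1.
  move=> uX; rewrite linear_sum {2}(const_expand uX) linear_sum /= scaler_suml.
  apply: eq_bigr => i _; rewrite linearZ [in RHS]linearZ /=.
  rewrite {1}(const_eval uX (homog_xi K i)) scalerA mulrC; congr (_ *: _).
split.
- by apply: memv_suml => i _; rewrite memvZ ?homog_xi.
- by move=> u uA; rewrite ev ?(subvP sA) // phiA // scale0r.
by rewrite ev // phiv scale1r.
Qed.

Definition fmul f D : E := (lmul f \o D)%VF.

Lemma fmulE f D g : fmul f D g = f * D g.
Proof. by rewrite comp_lfunE lmulE. Qed.

Lemma fmul_vect p q f D : f \in H p -> D \in X q -> fmul f D \in X (p + q)%N.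
Proof.
move=> fH DX; have /vect_degP[_ hD] := DX.
have -> : fmul f D = \sum_i fpder i (f * D (xi i)).
  apply/lfunP => g; rewrite fmulE {1}(vect_deg_expand DX) !sum_lfunE mulr_sumr.
  by apply: eq_bigr => i _; rewrite !fpderE mulrA.
rewrite /vect_deg subrK; apply: memv_sumr => i _; apply: memv_img.
exact: homogM.
Qed.

(** The term D (u xi_i) vanishes, as u xi_i is a constant: bracketing with a
    constant field just differentiates the coefficients. *)
Lemma sbracket_const p D u i : D \in X p -> u \in X 0 ->
  sbracket D u (xi i) = - (-1) ^+ (~~ odd p) *: u (D (xi i)).
Proof.
move=> DX uX; have /vect_degP[_ /(_ i) hu] := uX.
by rewrite (vect_degE _ DX uX) (vect_deg_const DX) // sub0r andbT scaleNr.
Qed.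

Lemma sbracket_fmul_const p f w u : f \in H p -> w \in X 0 -> u \in X 0 ->
  sbracket (fmul f w) u = - (-1) ^+ (~~ odd p) *: fmul (u f) w.
Proof.
move=> fH wX uX; have fw := fmul_vect fH wX; rewrite addn0 in fw.
apply: (@vect_deg_ext _ _ p.-1).
- by have := vect_deg_sbracket fw uX; rewrite addn0.
- by rewrite memvZ //; have := fmul_vect (vect_deg_homog uX fH) wX; rewrite addn0.
move=> i; rewrite (sbracket_const _ fw uX) scale_lfunE !fmulE const_mul //.
have /vect_degP[_ /(_ i) hw] := wX.
by rewrite (vect_deg_const uX hw) mulr0 addr0.
Qed.

Lemma sbracket_rank1 f w u k : f \in H 1 -> w \in X 0 -> u \in X 0 -> u f = k *: 1 ->
  sbracket (fmul f w) u = - k *: w.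
Proof.
move=> fH wX uX e; rewrite (sbracket_fmul_const fH) //= expr0 scaleN1r e.
by apply/lfunP => g; rewrite opp_lfunE fmulE scale_lfunE -scalerAl mul1r scaleNr.
Qed.

Lemma vect_deg_faithful p D : D \in X p.+1 ->
  {in X 0, forall u, sbracket D u = 0} -> D = 0.
Proof.
move=> DX h; apply: (vect_deg_ext DX); rewrite ?mem0v // => i; rewrite zero_lfunE.
have /vect_degP[_ /(_ i) hD] := DX.
apply: (homog_pder_eq0 hD) => j.
have := congr1 (fun D : E => D (xi i)) (h _ (pderX j)).
rewrite /= (sbracket_const _ DX (pderX j)) zero_lfunE => /eqP.
by rewrite scaler_eq0 oppr_eq0 signr_eq0 => /eqP.
Qed.

Definition euler : E := \sum_i fpder i (xi i).

Lemma euler_xi i : euler (xi i) = xi i.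
Proof. exact: sum_fpder_xi. Qed.

Lemma euler_vect : euler \in X 1.
Proof.
rewrite /vect_deg subrK; apply: memv_sumr => i _; apply: memv_img; exact: homog_xi.
Qed.

Lemma euler_const u : u \in X 0 -> sbracket euler u = - u.
Proof.
move=> uX; apply: (@vect_deg_ext _ _ 0).
- exact: vect_deg_sbracket euler_vect uX.
- by rewrite rpredN.
by move=> i; rewrite (sbracket_const _ euler_vect uX) euler_xi opp_lfunE expr0 scaleN1r.
Qed.

Lemma linear_form_expand f : f \in H 1 -> \sum_i pder i f * xi i = f.
Proof.
move=> fH; have d0 i : pder i f \in H 0 := homog_pder i fH.
apply/eqP; rewrite -subr_eq0; apply/eqP; apply: (@homog_pder_eq0 _ _ 0).
  rewrite rpredB //; apply: rpred_sum => i _.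
  exact: homogM (d0 i) (homog_xi K i).
move=> j; rewrite linearB linear_sum (bigD1 j) //= big1 ?addr0 => [|i nij].
  rewrite const_mul ?pderX // homog_pder0 // mul0r add0r (homog_sigma (d0 j)) scale1r.
  by rewrite -[xi j]mulr1 pder_xiM pder1 eqxx mulr0 subr0 mulr1 subrr.
rewrite const_mul ?pderX // homog_pder0 // mul0r add0r.
by rewrite -[xi i]mulr1 pder_xiM pder1 eq_sym (negPf nij) mulr0 subr0 mulr0.
Qed.

Lemma divE D : divergence D = \sum_i pder i (sigma (D (xi i))).
Proof. by rewrite lfunE. Qed.

Lemma div_homog p D : D \in X p -> divergence D \in H p.-1.
Proof.
move=> /vect_degP[_ hD]; rewrite divE; apply: rpred_sum => i _.
by rewrite (homog_sigma (hD i)) homog_pder // memvZ.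
Qed.

Lemma div_const u : u \in X 0 -> divergence u = 0.
Proof.
move=> /vect_degP[_ hD]; rewrite divE big1 // => i _.
by rewrite (homog_sigma (hD i)) homog_pder0 // memvZ.
Qed.

Lemma div_sbracket_const p D u : D \in X p -> u \in X 0 ->
  divergence (sbracket D u) = - (-1) ^+ (~~ odd p) *: u (divergence D).
Proof.
move=> DX uX; rewrite (divE (sbracket D u)) (divE D) (linear_sum u) scaler_sumr.
apply: eq_bigr => i _ /=.
have su g : sigma (u g) = - u (sigma g).
  by rewrite (has_parity_sigma _ (vect_deg_parity uX)) /= expr1 scaleN1r opprK.
rewrite (sbracket_const _ DX uX) 2!linearZ /= su linearN /= (const_anticomm _ (pderX i) uX).
by rewrite opprK.
Qed.

Lemma div_fmul p f w : f \in H p -> w \in X 0 ->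
  divergence (fmul f w) = (-1) ^+ p *: w f.
Proof.
move=> fH wX; rewrite divE {2}(const_expand wX) sum_lfunE scaler_sumr.
apply: eq_bigr => i _; have /vect_degP[_ /(_ i) hw] := wX.
rewrite fmulE sigmaM (homog_sigma fH) (homog_sigma hw) expr0 scale1r.
rewrite {1}(homog0 hw) -scalerAr mulr1 !linearZ /= scale_lfunE scalerA mulrC.
by rewrite -scalerA.
Qed.

Lemma div_fmul_euler f : f \in H 1 -> divergence (fmul f euler) = (1 - n%:R) *: f.
Proof.
move=> fH; rewrite divE.
under eq_bigr => i _.
  rewrite fmulE euler_xi (homog_sigma (homogM fH (homog_xi K i))) expr2 mulrNN mulr1 scale1r.
  rewrite const_mul ?pderX // (homog_sigma fH) expr1 scaleN1r.
  rewrite -{2}[xi i]mulr1 pder_xiM pder1 eqxx mulr0 subr0 mulr1n mulr1.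
  over.
rewrite big_split /= linear_form_expand // sumr_const card_ord.
by rewrite scalerBl scale1r scaler_nat mulNrn.
Qed.

(** The bracket with a constant field u differentiates the divergence along u, and
    the divergence of a field of positive degree has no constant term. *)
Lemma div_free_const p D : D \in X p.+2 ->
  {in X 0, forall u, divergence (sbracket D u) = 0} -> divergence D = 0.
Proof.
move=> DX h; apply: (homog_pder_eq0 (div_homog DX)) => i.
have := h _ (pderX i); rewrite (div_sbracket_const DX (pderX i)) => /eqP.
by rewrite scaler_eq0 oppr_eq0 signr_eq0 => /eqP.
Qed.

Lemma homog_Xi : Xi \in H n.
Proof.
suff : Xi \in H (\sum_(i < n) 1)%N by rewrite sum1_card card_ord.
rewrite /Defs.Xi; apply: (big_ind2 (fun f p => f \in H p)) => [|f p g q|i _].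
- exact: homog1.
- exact: homogM.
exact: homog_xi.
Qed.

Lemma Xi_neq0 : Xi != 0.
Proof.
rewrite /Defs.Xi; have := index_enum_uniq 'I_n.
elim: (index_enum _) => [|j s IH] /=; first by rewrite big_nil oner_neq0.
case/andP=> js us; rewrite big_cons; apply: contra (IH us) => /eqP e.
have := congr1 (pder j) e; rewrite pder_xiM linear0 eqxx.
suff -> : pder j (\prod_(i <- s) xi i) = 0 by rewrite mulr0 subr0 mulr1n => ->.
elim: s js {IH us e} => [|i s IH]; first by rewrite big_nil pder1.
rewrite inE negb_or => /andP[nij js].
by rewrite big_cons pder_xiM (negPf nij) IH // mulr0 subr0.
Qed.

Lemma linear_Xi f : f \in H 1 -> f * Xi = 0.
Proof. by move=> fH; apply: homog_big (homogM fH homog_Xi); rewrite add1n. Qed.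

(** The i-th component f_i is a linear form, so f_i Xi = 0, and differentiating this
    gives f_i d_i Xi = (d_i f_i) Xi. *)
Lemma vect0_Xi D : D \in X 1 -> D Xi = - divergence D * Xi.
Proof.
move=> DX; rewrite {1}(vect_deg_expand DX) sum_lfunE divE -sumrN mulr_suml.
apply: eq_bigr => i _; have /vect_degP[_ /(_ i) hD] := DX.
rewrite fpderE (homog_sigma hD) expr1 scaleN1r linearN opprK.
have := congr1 (pder i) (linear_Xi hD).
rewrite linear0 const_mul ?pderX // (homog_sigma hD) expr1 scaleN1r mulNr.
by move/eqP; rewrite subr_eq0 => /eqP.
Qed.

(** In degree 0 the divergence is, up to sign, the trace, read off from the action
    on the top monomial, a one-dimensional representation. *)
Lemma div_sbracket_vect0 D D' : D \in X 1 -> D' \in X 1 -> divergence (sbracket D D') = 0.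
Proof.
move=> DX DX';
have eXi F : F \in X 1 -> F Xi = - (divergence F set0 : K) *: Xi.
  by move=> FX; rewrite (vect0_Xi FX) {1}(homog0 (div_homog FX)) mulNr -scalerAl mul1r scaleNr.
have BX := vect_deg_sbracket DX DX'; have hB := div_homog BX.
have : divergence (sbracket D D') * Xi = 0.
  apply: oppr_inj; rewrite -mulNr -(vect0_Xi BX) (vect_degE _ DX DX') expr0 scale1r oppr0.
  by rewrite (eXi _ DX) (eXi _ DX') !linearZ /= (eXi _ DX) (eXi _ DX') scalerN !scalerA mulrC subrr.
rewrite (homog0 hB) -scalerAl mul1r => /eqP.
by rewrite scaler_eq0 (negPf Xi_neq0) orbF => /eqP->; rewrite scale0r.
Qed.
End ConstantFields.

(** * Lie's theorem *)

(** The two properties of the complex field that Lie's theorem uses. *)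
Definition split_polys (K : fieldType) :=
  forall p : {poly K}, exists rs, p = lead_coef p *: \prod_(r <- rs) ('X - r%:P).
Definition char_zero (K : fieldType) := forall k, k.+1%:R != 0 :> K.

Section WeightVector.
Variables (K : fieldType) (M : vectType K).
Hypotheses (Ksplit : split_polys K) (K0 : char_zero K).
Implicit Types (A B U : {vspace M}) (u v w : M) (y z : 'End(M)).

Lemma line_addP A v w :
  reflect (exists k, w - k *: v \in A) (w \in (A + <[v]>)%VS).
Proof.
apply: (iffP memv_addP) => [[a aA [_ /vlineP[k ->] ->]]|[k h]].
  by exists k; rewrite addrK.
by exists (w - k *: v) => //; exists (k *: v); rewrite ?memvZ ?memv_line // subrK.
Qed.

Variables (A B : {vspace M}) (z : 'End(M)) (P : 'End(M) -> Prop).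
Hypotheses (zA : {in A, forall u, z u \in A}) (zB : {in B, forall u, z u \in B}).
Hypothesis PA : forall y, P y -> {in A, forall u, y u \in A}.
Hypothesis Pz : forall y, P y ->
  exists2 y', P y' & {in B, forall u, y' u = z (y u) - y (z u)}.

Section Krylov.
Variable v : M.
Hypotheses (vB : v \in B) (vA : v \notin A).

Let u_ i := iter i z v.
Fixpoint krylov k : {vspace M} := if k is k'.+1 then (krylov k' + <[u_ k']>)%VS else A.

Lemma krylov_le i k : (i <= k)%N -> (krylov i <= krylov k)%VS.
Proof.
elim: k => [|k IH]; first by rewrite leqn0 => /eqP->.
rewrite leq_eqVlt => /orP[/eqP->//|/IH h].
exact: subv_trans h (addvSl _ _).
Qed.

Lemma krylov_mem i k : (i < k)%N -> u_ i \in krylov k.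
Proof.
by move=> ik; apply: (subvP (krylov_le ik)); apply: (subvP (addvSr _ _)); apply: memv_line.
Qed.

Lemma krylov_z k w : w \in krylov k -> z w \in krylov k.+1.
Proof.
elim: k w => [|k IH] w; first by move=> /zA h; apply: (subvP (addvSl _ _)).
case/line_addP=> c /IH; rewrite linearB linearZ /= => h.
rewrite -[z w](subrK (c *: z (u_ k))) memvD ?memvZ //.
  by apply: (subvP (addvSl _ _)).
by apply: (@krylov_mem k.+1 k.+2).
Qed.

Lemma krylov_stop : exists2 k, u_ k \notin krylov k & u_ k.+1 \in krylov k.+1.
Proof.
have ex : exists k, u_ k \in krylov k.
  have [/existsP[k hk]|/existsPn h] := boolP [exists k : 'I_(\dim {:M}).+1, u_ k \in krylov k].
    by exists k.
  suff h' k : (k <= (\dim {:M}).+1)%N -> (k <= \dim (krylov k))%N.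
    by have := leq_trans (h' _ (leqnn _)) (dimvS (subvf _)); rewrite ltnn.
  elim: k => // k IH kd; apply: leq_ltn_trans (IH (ltnW kd)) _.
  have := h (Ordinal kd); rewrite /= => nu.
  rewrite ltn_neqAle dimvS ?addvSl // andbT; apply: contra nu => /eqP e.
  have /eqP -> : krylov k == krylov k.+1 by rewrite eqEdim addvSl e /=.
  exact: krylov_mem.
case: (ex_minnP ex) => -[|k] uk kmin; first by rewrite (negPf vA) in uk.
by exists k => //; apply/negP => /kmin; rewrite ltnn.
Qed.

Lemma krylovB i : u_ i \in B.
Proof. by elim: i => //= i; apply: zB. Qed.

Variable lam : 'End(M) -> K.
Hypothesis vlam : forall y, P y -> y v - lam y *: v \in A.

(** Modulo lower terms, y acts on z ^ k v by the weight of v, and the first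
    correction is k times the weight of [z, y]. *)
Lemma krylov_weight k :
  (forall y, P y -> y (u_ k) - lam y *: u_ k \in krylov k) /\
  (forall y y', P y -> P y' -> {in B, forall u, y' u = z (y u) - y (z u)} ->
    y (u_ k.+1) - lam y *: u_ k.+1 + (k.+1%:R * lam y') *: u_ k \in krylov k).
Proof.
have next y y' i : {in B, forall u, y' u = z (y u) - y (z u)} ->
    y (u_ i.+1) = z (y (u_ i)) - y' (u_ i).
  by move=> e; rewrite e ?krylovB // subKr.
elim: k => [|k [IH1 IH2]].
  split=> // y y' Py Py' e; rewrite (next _ _ _ e) /= mul1r.
  have := memvB (zA (vlam Py)) (vlam Py'); rewrite linearB linearZ /=.
  congr (is_true (_ \in A)); rewrite opprB -/(z v).
  by rewrite [lam y' *: v - _]addrC addrA; congr (_ + _); rewrite addrAC.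
have T y : P y -> y (u_ k.+1) - lam y *: u_ k.+1 \in krylov k.+1.
  move=> Py; have [y' Py' e] := Pz Py.
  rewrite -[_ - _](addrK ((k.+1%:R * lam y') *: u_ k)) memvB //.
    by apply: (subvP (addvSl _ _)); apply: IH2.
  by rewrite memvZ // (@krylov_mem k k.+1).
split=> // y y' Py Py' e; rewrite (next _ _ _ e).
have := memvB (krylov_z (IH2 _ _ Py Py' e)) (T _ Py').
move: (krylov k.+1) => Q.
rewrite linearD linearB !linearZ /= -/(u_ k.+1) -/(u_ k.+2); congr (is_true (_ \in Q)).
rewrite -[k.+2]addn1 natrD mulrDl mul1r scalerDl !scalerN opprB.
set a := z (y _); set b := y' _; set l := lam y *: _.
by rewrite [a - b - l]addrAC [RHS]addrACA; congr (_ + _); rewrite addrC.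
Qed.

(** The weight of a commutator vanishes: at the step where the Krylov sequence
    closes up, (k+1) lam([z, y]) z^k v must be a combination of lower terms. *)
Lemma weight_commutator y y' : P y -> P y' ->
  {in B, forall u, y' u = z (y u) - y (z u)} -> lam y' = 0.
Proof.
move=> Py Py' e; have [k nuk uk] := krylov_stop.
have low w i : (i <= k.+1)%N -> w \in krylov i -> y w - lam y *: w \in krylov k.
  elim: i w => [|i IH] w ik.
    by move=> wA; apply: (subvP (krylov_le (leq0n k))); rewrite memvB ?memvZ ?PA.
  case/line_addP=> c /(IH _ (ltnW ik)) h.
  have := memvD h (memvZ c (subvP (@krylov_le i k ik) _ ((krylov_weight i).1 _ Py))).
  congr (is_true (_ \in krylov k)); rewrite linearB linearZ /= !scalerBr !scalerA [c * _]mulrC.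
  by rewrite opprB addrAC [X in X + _]addrA subrK addrA subrK.
have := memvB ((krylov_weight k).2 _ _ Py Py' e) (low _ _ (leqnn _) uk).
rewrite addrC addKr; apply: contraTeq => nl.
have nz : k.+1%:R * lam y' != 0 by rewrite mulf_neq0.
apply: contra nuk => h.
by rewrite -[u_ k]scale1r -(mulVf nz) -scalerA memvZ.
Qed.

Definition poly_act (p : {poly K}) : M := \sum_(i < size p) p`_i *: u_ i.

Lemma poly_act_widen N (p : {poly K}) : (size p <= N)%N -> poly_act p = \sum_(i < N) p`_i *: u_ i.
Proof.
move=> pN; rewrite /poly_act (big_ord_widen N (fun i => p`_i *: u_ i) pN).
rewrite big_mkcond; apply: eq_bigr => i _; case: ltnP => // h.
by rewrite nth_default // scale0r.
Qed.

Lemma poly_actB (p q : {poly K}) c : poly_act (p - c *: q) = poly_act p - c *: poly_act q.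
Proof.
pose N := maxn (size p) (size q).
have hp : (size p <= N)%N by rewrite leq_maxl.
have hq : (size q <= N)%N by rewrite leq_maxr.
rewrite (@poly_act_widen N) ?(poly_act_widen hp) ?(poly_act_widen hq).
  rewrite scaler_sumr -sumrB; apply: eq_bigr => i _.
  by rewrite coefB coefZ scalerBl scalerA.
apply: leq_trans (size_polyD _ _) _; rewrite geq_max hp size_polyN.
exact: leq_trans (size_scale_leq _ _) hq.
Qed.

Lemma poly_actZ c (p : {poly K}) : poly_act (c *: p) = c *: poly_act p.
Proof.
have e0 : poly_act 0 = 0 by rewrite /poly_act size_poly0 big_ord0.
by rewrite -[c *: p]opprK -scaleNr -[- (_ *: p)]add0r poly_actB e0 sub0r scaleNr opprK.
Qed.

Lemma poly_actX (p : {poly K}) : poly_act ('X * p) = z (poly_act p).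
Proof.
rewrite (@poly_act_widen (size p).+1); last first.
  have [->|p0] := eqVneq p 0; first by rewrite mulr0 size_poly0.
  by rewrite mulrC size_mulX.
rewrite big_ord_recl coefXM eqxx scale0r add0r linear_sum.
by apply: eq_bigr => i _; rewrite linearZ /= coefXM.
Qed.

Lemma poly_act_Xn i : poly_act 'X^i = u_ i.
Proof.
elim: i => [|i IH]; last by rewrite exprS poly_actX IH.
by rewrite /poly_act expr0 size_poly1 big_ord1 coef1 scale1r.
Qed.

Lemma krylov_poly k w : w \in krylov k ->
  exists2 p : {poly K}, (size p <= k)%N & w - poly_act p \in A.
Proof.
elim: k w => [|k IH] w; first by exists 0; rewrite ?size_poly0 // /poly_act size_poly0 big_ord0 subr0.
case/line_addP=> c /IH[p sp h]; exists (p - (- c) *: 'X^k).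
  apply: leq_trans (size_polyD _ _) _; rewrite geq_max (leq_trans sp) // size_polyN.
  by apply: leq_trans (size_scale_leq _ _) _; rewrite size_polyXn.
by rewrite poly_actB poly_act_Xn scaleNr opprK opprD addrA addrAC.
Qed.

Lemma annihilating_poly : exists2 p : {poly K}, p != 0 & poly_act p \in A.
Proof.
have [k _ /krylov_poly[p sp h]] := krylov_stop.
exists ('X^(k.+1) - 1 *: p); last by rewrite poly_actB poly_act_Xn scale1r.
rewrite scale1r -size_poly_gt0 size_polyDl size_polyXn // size_polyN.
by rewrite ltnS.
Qed.

Definition factors_act (rs : seq K) (v' : M) := foldr (fun r w => z w - r *: w) v' rs.

Lemma poly_act_factors rs : poly_act (\prod_(r <- rs) ('X - r%:P)) = factors_act rs v.
Proof.
elim: rs => [|r rs IH]; first by rewrite big_nil; have := poly_act_Xn 0; rewrite expr0.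
by rewrite big_cons mulrBl mul_polyC poly_actB poly_actX IH.
Qed.

End Krylov.

(** A common weight vector of P modulo A, of weight lam say, can be corrected
    into a weight vector of z as well: the vectors of weight lam are stable
    under z because lam vanishes on commutators, and z has an eigenvector among
    them since the field is algebraically closed. *)
Lemma extend_weight_vector v0 : v0 \in B -> v0 \notin A ->
  (forall y, P y -> y v0 \in (A + <[v0]>)%VS) ->
  exists v, [/\ v \in B, v \notin A, forall y, P y -> y v \in (A + <[v]>)%VS
              & z v \in (A + <[v]>)%VS].
Proof.
move=> vB vA hv; have [phi [phiA phiv]] := exists_functional vA.
pose lam y : K := phi (y v0).
have vlam y : P y -> y v0 - lam y *: v0 \in A.
  move=> /hv/line_addP[c h]; suff -> : lam y = c by [].
  have := phiA _ h; rewrite linearB linearZ /= phiv => /eqP.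
  by rewrite subr_eq0 => /eqP; rewrite /lam => ->; apply: mulr1.
pose weight u := u \in B /\ forall y, P y -> y u - lam y *: u \in A.
have weight_step r u : weight u -> weight (z u - r *: u).
  case=> uB ulam; split=> [|y Py]; first by rewrite memvB ?zB ?memvZ.
  have [y' Py' e] := Pz Py.
  have l0 : lam y' = 0 := weight_commutator vB vA vlam Py Py' e.
  have y'u : y' u \in A by have := ulam _ Py'; rewrite l0 scale0r subr0.
  have yz : y (z u) = z (y u) - y' u by rewrite e // subKr.
  have -> : y (z u - r *: u) - lam y *: (z u - r *: u)
          = z (y u - lam y *: u) - y' u - r *: (y u - lam y *: u).
    have e1 : y (z u - r *: u) = z (y u) - y' u - r *: y u by rewrite linearB linearZ /= yz.
    have e2 : z (y u - lam y *: u) = z (y u) - lam y *: z u by rewrite linearB linearZ.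
    rewrite e1 e2 !scalerBr !scalerA [r * _]mulrC !opprB.
    rewrite [z (y u) - _ - y' u]addrAC [LHS]addrACA [RHS]addrACA; congr (_ + _).
    by rewrite addrC.
  by rewrite memvB ?memvZ ?ulam // memvB // zA ?ulam.
have weight_act rs : weight (factors_act rs v0).
  by elim: rs => [|r rs IH] /=; [split | apply: weight_step].
have [p p0] := annihilating_poly vA.
have [rs ep] := Ksplit p.
rewrite ep poly_actZ poly_act_factors => hA.
have {hA} : factors_act rs v0 \in A.
  have l0 : lead_coef p != 0 by rewrite lead_coef_eq0.
  by rewrite -[factors_act _ _]scale1r -(mulVf l0) -scalerA memvZ.
elim: rs {ep} => [|r rs IH] /=; first by rewrite (negPf vA).
have [//|nA] := boolP (factors_act rs v0 \in A); first by move=> h _; apply: IH h.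
move=> hr; have [uB ulam] := weight_act rs.
exists (factors_act rs v0); split=> // [y Py|]; last by apply/line_addP; exists r.
by apply/line_addP; exists (lam y); apply: ulam.
Qed.

End WeightVector.

Section BracketLinear.
Variables (K : fieldType) (n : nat).
Implicit Types (D v w : 'End(grassmann K n)) (k : K).

Lemma linear_rules (U V : lmodType K) (f : U -> V) : linear f ->
  [/\ f 0 = 0, {morph f : x y / x + y}, {morph f : x y / x - y},
      {morph f : x / - x} & forall k, {morph f : x / k *: x}].
Proof.
move=> h.
have f0 : f 0 = 0 by have := h (-1) 0 0; rewrite scaler0 addr0 scaleN1r addNr.
have fD x y : f (x + y) = f x + f y by have := h 1 x y; rewrite !scale1r.
have fZ k x : f (k *: x) = k *: f x by have := h k x 0; rewrite f0 !addr0.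
by split=> // [x y|x]; rewrite -scaleN1r ?fD fZ scaleN1r.
Qed.

Lemma sbracket0r D : sbracket D 0 = 0.
Proof. by case: (linear_rules (sbracket_is_linear D)) => h _ _ _ _; apply: h. Qed.
Lemma sbracketDr D v w : sbracket D (v + w) = sbracket D v + sbracket D w.
Proof. by case: (linear_rules (sbracket_is_linear D)) => _ h _ _ _; apply: h. Qed.
Lemma sbracketBr D v w : sbracket D (v - w) = sbracket D v - sbracket D w.
Proof. by case: (linear_rules (sbracket_is_linear D)) => _ _ h _ _; apply: h. Qed.
Lemma sbracketNr D v : sbracket D (- v) = - sbracket D v.
Proof. by case: (linear_rules (sbracket_is_linear D)) => _ _ _ h _; apply: h. Qed.
Lemma sbracketZr D k v : sbracket D (k *: v) = k *: sbracket D v.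
Proof. by case: (linear_rules (sbracket_is_linear D)) => _ _ _ _ h; apply: h. Qed.

Lemma sbracket0l D : sbracket 0 D = 0.
Proof. by case: (linear_rules (rbracket_is_linear D)) => h _ _ _ _; apply: h. Qed.
Lemma sbracketDl D v w : sbracket (v + w) D = sbracket v D + sbracket w D.
Proof. by case: (linear_rules (rbracket_is_linear D)) => _ h _ _ _; apply: h. Qed.
Lemma sbracketBl D v w : sbracket (v - w) D = sbracket v D - sbracket w D.
Proof. by case: (linear_rules (rbracket_is_linear D)) => _ _ h _ _; apply: h. Qed.
Lemma sbracketZl D k v : sbracket (k *: v) D = k *: sbracket v D.
Proof. by case: (linear_rules (rbracket_is_linear D)) => _ _ _ _ h; apply: h. Qed.

End BracketLinear.

Lemma memv_two_steps (K : fieldType) (M : vectType K) (W : {vspace M}) c c' (u v w : M) :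
  w - c *: u \in W -> u - c' *: v \in W -> w - (c * c') *: v \in W.
Proof.
move=> h1 h2; rewrite (_ : _ - _ = w - c *: u + c *: (u - c' *: v)).
  by rewrite memvD ?memvZ.
by rewrite scalerBr scalerA addrA subrK.
Qed.

Lemma cancel_right (V : zmodType) (p q t : V) : p - t - (q - t) = p - q.
Proof. by rewrite opprB addrA subrK. Qed.

Section Lie.
Variables (K : fieldType) (n : nat).
Hypotheses (Ksplit : split_polys K) (K0 : char_zero K).
Local Notation E := 'End(grassmann K n).
Local Notation X p := (vect_deg K n (p%:Z - 1)).
Implicit Types (A B T U W : {vspace E}) (D u v w x y : E).

Lemma bracket_into_line D v W : (D \in bracket_into <[v]> W) = (sbracket D v \in W).
Proof.
apply/bracket_intoP/idP => [|h _ /vlineP[k ->]]; first by apply; apply: memv_line.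
by rewrite sbracketZr memvZ.
Qed.

Lemma bracket_intoS U U' W W' : (U' <= U)%VS -> (W <= W')%VS ->
  (bracket_into U W <= bracket_into U' W')%VS.
Proof.
move=> sU sW; apply/subvP => D /bracket_intoP h; apply/bracket_intoP => u uU'.
by apply: (subvP sW); apply: h; apply: (subvP sU).
Qed.

Lemma brspan_mem U W D D' : D \in U -> D' \in W -> sbracket D D' \in brspan U W.
Proof. by move=> DU DW; have /brspanP := subvv (brspan U W); apply. Qed.

Lemma brspanS U U' W W' : (U <= U')%VS -> (W <= W')%VS -> (brspan U W <= brspan U' W')%VS.
Proof.
move=> sU sW; apply/brspanP => D D' DU DW.
by apply: brspan_mem; [apply: (subvP sU) | apply: (subvP sW)].
Qed.

Lemma derived_shift U k : derived U k.+1 = derived (brspan U U) k.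
Proof. by elim: k => //= k ->. Qed.

Lemma derivedS U U' k : (U <= U')%VS -> (derived U k <= derived U' k)%VS.
Proof. by move=> s; elim: k => //= k IH; apply: brspanS. Qed.

Lemma solvableS U U' : (U <= U')%VS -> lie_solvable U' -> lie_solvable U.
Proof.
move=> s [k dk]; exists k; apply/eqP; rewrite -subv0 -dk; exact: derivedS.
Qed.

Lemma jacobi_const x y u : x \in X 1 -> y \in X 1 -> u \in X 0 ->
  sbracket (sbracket x y) u = sbracket x (sbracket y u) - sbracket y (sbracket x u).
Proof.
move=> /vect_deg_parity px /vect_deg_parity py /vect_deg_parity pu.
rewrite (jacobi px py pu) expr0 scale1r; congr (_ + _).
by rewrite (sbracketC (has_parity_sbracket px pu) py) /= scaleN1r.
Qed.

(** Modulo A the elements of T act on v by scalars, and scalars commute. *)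
Lemma commutators_kill T A v : (T <= X 1)%VS -> (A <= X 0)%VS -> v \in X 0 ->
  (T <= bracket_into A A)%VS -> (T <= bracket_into <[v]> (A + <[v]>))%VS ->
  (brspan T T <= bracket_into <[v]> A)%VS.
Proof.
move=> TX AX vX TA Tv; apply/brspanP => x y xT yT; rewrite bracket_into_line.
have ev z : z \in T -> exists2 c, sbracket z v - c *: v \in A & z \in X 1.
  move=> zT; have /line_addP[c h] : sbracket z v \in (A + <[v]>)%VS.
    by rewrite -bracket_into_line (subvP Tv).
  by exists c => //; apply: (subvP TX).
have [a ha xX] := ev _ xT; have [b hb yX] := ev _ yT.
have key z z' c c' : z \in T -> sbracket z v - c *: v \in A ->
    sbracket z' v - c' *: v \in A -> sbracket z (sbracket z' v) - (c' * c) *: v \in A.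
  move=> zT hz hz'; have /bracket_intoP/(_ _ hz') := subvP TA _ zT.
  rewrite sbracketBr sbracketZr => h; exact: memv_two_steps h hz.
rewrite jacobi_const //; have := memvB (key _ _ _ _ xT ha hb) (key _ _ _ _ yT hb ha).
by rewrite [b * a]mulrC cancel_right.
Qed.

Definition ad x : 'End(E) := linfun (sbracket x).

Lemma adE x u : ad x u = sbracket x u.
Proof. exact: lfunE. Qed.

(** Lie's theorem, for each quotient B / A of stable subspaces: by induction along
    the derived series, and by adding to [T, T] one element of T at a time; each
    partial sum is an ideal, as it contains [T, T]. *)
Lemma lie_eigenvector T A B : lie_solvable T -> (brspan T T <= T)%VS ->
  (T <= X 1)%VS -> (A <= B)%VS -> (B <= X 0)%VS -> A != B ->
  (T <= bracket_into A A)%VS -> (T <= bracket_into B B)%VS ->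
  exists v, [/\ v \in B, v \notin A & (T <= bracket_into <[v]> (A + <[v]>))%VS].
Proof.
move=> [k dk] + + AB BX nAB; elim: k T dk => [|k IH] T; first rewrite [derived _ _]/=; move=> dk TT TX TA TB.
  have [v vB vA] : exists2 v, v \in B & v \notin A.
    apply/subvPn; apply: contra nAB => BA; by rewrite eqEsubv AB.
  by exists v; split=> //; rewrite dk sub0v.
rewrite derived_shift in dk; set T' := brspan T T in dk TT.
have [v0 [v0B v0A hv0]] : exists v, [/\ v \in B, v \notin A &
    (T' <= bracket_into <[v]> (A + <[v]>))%VS].
  apply: IH => //; rewrite ?(subv_trans TT) //; exact: brspanS.
suff ext (r : seq E) : {subset r <= T} -> exists v, [/\ v \in B, v \notin A &
    (T' + <<r>> <= bracket_into <[v]> (A + <[v]>))%VS].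
  have [|v [vB vA hv]] := ext (vbasis T); first by move=> x /vbasis_mem.
  exists v; split=> //; apply: subv_trans hv.
  by rewrite (span_basis (vbasisP T)) addvSr.
elim: r => [|x r IHr] rT; first by exists v0; split=> //; rewrite span_nil addv0.
have [|v [vB vA hv]] := IHr; first by move=> y yr; apply: rT; rewrite inE yr orbT.
have xT : x \in T by apply: rT; rewrite inE eqxx.
have rsT : (T' + <<r>> <= T)%VS.
  rewrite subv_add TT; apply/span_subvP => y yr; apply: rT.
  by rewrite inE yr orbT.
pose P (f : 'End(E)) := exists2 y, y \in (T' + <<r>>)%VS & f = ad y.
have stab U y : (T <= bracket_into U U)%VS -> y \in T -> {in U, forall u, ad y u \in U}.
  by move=> TU /(subvP TU)/bracket_intoP h u uU; rewrite adE; apply: h.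
have Px f : P f -> exists2 f', P f' & {in B, forall u, f' u = ad x (f u) - f (ad x u)}.
  case=> z zr ->; have zT := subvP rsT _ zr.
  exists (ad (sbracket x z)).
    by exists (sbracket x z) => //; apply: (subvP (addvSl _ _)); apply: brspan_mem.
  move=> u uB; rewrite (adE (sbracket x z)) (adE x) (adE z) (adE x) (adE z).
  apply: jacobi_const; rewrite ?(subvP TX) //.
  exact: (subvP BX).
have [||w [wB wA hw xw]] := extend_weight_vector Ksplit K0 (stab _ _ TA xT) (stab _ _ TB xT)
  _ Px vB vA.
- by move=> f [z zr ->]; apply: stab => //; apply: (subvP rsT).
- by move=> f [z zr ->]; rewrite adE -bracket_into_line (subvP hv).
exists w; split=> //; rewrite span_cons addvA [(T' + _)%VS]addvC -addvA subv_add; apply/andP; split.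
  by rewrite -memvE bracket_into_line -adE.
apply/subvP => y yr; rewrite bracket_into_line -adE; apply: hw.
by exists y.
Qed.

(** A commutator lowers every T-stable flag with lines as quotients, and by Lie's
    theorem such a flag can be climbed from 0 until it contains w. *)
Lemma commutator_nilpotent T B x y w c : lie_solvable T -> (brspan T T <= T)%VS ->
  (T <= X 1)%VS -> (B <= X 0)%VS -> (T <= bracket_into B B)%VS ->
  x \in T -> y \in T -> w \in B -> sbracket (sbracket x y) w = c *: w -> c != 0 -> w = 0.
Proof.
move=> sT TT TX BX TB xT yT wB e c0; apply/eqP; apply: contraT => w0.
have [m] := ubnP (\dim B).
suff : forall A, (\dim B < m + \dim A)%N -> (A <= B)%VS ->
  (T <= bracket_into A A)%VS -> w \notin A -> false.
  move=> h Bm; apply: (h 0%VS); rewrite ?dimv0 ?addn0 ?sub0v ?memv0 //.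
  by apply/subvP => z zT; apply/bracket_intoP => u; rewrite memv0 => /eqP->; rewrite sbracket0r mem0v.
elim: m => [|m IH] A dA AB TA wA; first by rewrite ltnNge dimvS in dA.
have nAB : A != B by apply: contraNneq wA => ->.
have [v [vB vA hv]] := lie_eigenvector sT TT TX AB BX nAB TA TB.
have kill := commutators_kill TX (subv_trans AB BX) (subvP BX _ vB) TA hv.
pose A' := (A + <[v]>)%VS.
have dA' : (\dim A < \dim A')%N.
  rewrite ltn_neqAle dimvS ?addvSl // andbT; apply: contra vA => /eqP eA.
  have /eqP -> : A == A' by rewrite eqEdim addvSl eA /=.
  by apply: (subvP (addvSr _ _)); apply: memv_line.
apply: (IH A').
- by apply: leq_trans dA _; rewrite addSnnS leq_add2l.
- by rewrite subv_add AB -memvE.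
- apply/subvP => z zT; apply/bracket_intoP => u /line_addP[k hk].
  rewrite -[u](subrK (k *: v)) sbracketDr sbracketZr memvD ?memvZ //.
    apply: (subvP (addvSl _ _)); have /(subvP TA)/bracket_intoP := zT; exact.
  by rewrite -bracket_into_line (subvP hv).
apply: contra wA => /line_addP[k hk].
have wX := subvP BX _ wB.
have : sbracket (sbracket x y) w \in A.
  rewrite -[w](subrK (k *: v)) sbracketDr sbracketZr memvD ?memvZ //.
    have /(subvP TA)/bracket_intoP h : sbracket x y \in T by rewrite (subvP TT) ?brspan_mem.
    exact: h.
  by rewrite -bracket_into_line (subvP kill) ?brspan_mem.
by rewrite e => h; rewrite -[w]scale1r -(mulVf c0) -scalerA memvZ.
Qed.

End Lie.

(** * Closure and solvability of prolongs *)

Section Prolong.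
Variables (K : fieldType) (n : nat).
Hypotheses (Ksplit : split_polys K) (K0 : char_zero K).
Variable s : bool.
Local Notation E := 'End(grassmann K n).
Local Notation X p := (vect_deg K n (p%:Z - 1)).
Local Notation divergence := (@divergence K n).
Implicit Types (A B T U W Z : {vspace E}) (D u v w x y : E).

Lemma sbracket_jacobi_mem p q r Z D D' u : D \in X p -> D' \in X q -> u \in X r ->
  sbracket D (sbracket D' u) \in Z -> sbracket (sbracket D u) D' \in Z ->
  sbracket (sbracket D D') u \in Z.
Proof.
move=> /vect_deg_parity a /vect_deg_parity b /vect_deg_parity c h1 h2.
by rewrite (jacobi a b c); apply: memvD h1 (memvZ _ h2).
Qed.

Lemma sbracket_sym_mem p q Z D D' : D \in X p -> D' \in X q ->
  sbracket D D' \in Z -> sbracket D' D \in Z.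
Proof.
by move=> /vect_deg_parity a /vect_deg_parity b h; rewrite (sbracketC b a) memvZ.
Qed.

(** Both vect and svect are treated at once; a field of degree p - 1 is indexed by
    the degree p of its coefficients. *)
Definition cartan : graded_vf K n := if s then svect K n else vect K n.
Local Notation C p := (component cartan (p%:Z - 1)).

Lemma cartanP p D : D \in C p <-> D \in X p /\ (s -> divergence D = 0).
Proof.
rewrite /cartan; case: s => /=; last by split=> [h|[]].
by rewrite memv_cap memv_ker; split=> [/andP[-> /eqP->]|[-> /(_ isT) ->]] //=.
Qed.

Lemma cartan_sub p : (C p <= X p)%VS.
Proof. by apply/subvP => D /cartanP[]. Qed.

Lemma cartan_const : C 0 = X 0.
Proof.
apply/vspaceP => D; apply/idP/idP => [/cartanP[]//|DX].
by apply/cartanP; split=> // _; apply: div_const.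
Qed.

Lemma degS k : (k.+1)%:Z - 1 = k%:Z.
Proof. by rewrite -addn1 PoszD addrK. Qed.

Lemma cartan_sbracket_const p D u : D \in C p.+1 -> u \in X 0 -> sbracket D u \in C p.
Proof.
case/cartanP=> DX dD uX; apply/cartanP; split.
  by have := vect_deg_sbracket DX uX; rewrite addn0.
by move=> /dD e; rewrite (div_sbracket_const DX uX) e linear0 scaler0.
Qed.

Lemma cartan_extend p D : D \in X p.+2 ->
  {in X 0, forall u, sbracket D u \in C p.+1} -> D \in C p.+2.
Proof.
move=> DX h; apply/cartanP; split=> // hs; apply: (div_free_const DX) => u uX.
by have /cartanP[_ ->] := h _ uX.
Qed.

(** By induction on the degree: a field lies in the algebra as soon as its brackets
    with the constant fields do, and in degree 0 the trace of a commutator is 0. *)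
Lemma cartan_sbracket p q D D' : D \in C p.+1 -> D' \in C q.+1 ->
  sbracket D D' \in C (p + q).+1.
Proof.
move: {-1}(p + q)%N (erefl (p + q)%N) => m; elim: m p q D D' => [|m IH] p q D D' e DC DC'.
  have [p0 q0] : p = 0%N /\ q = 0%N by move: p q e {DC DC'} => [] // [].
  rewrite {}p0 {}q0 in DC DC' *; move/cartanP: DC => [DX _]; move/cartanP: DC' => [DX' _].
  apply/cartanP; split; first exact: vect_deg_sbracket DX DX'.
  by move=> _; apply: div_sbracket_vect0.
have [DX _] := (cartanP _ _).1 DC; have [DX' _] := (cartanP _ _).1 DC'.
apply: cartan_extend => [|u uX].
  have -> : m.+2 = (p.+1 + q.+1).-1 by rewrite addSn addnS e.
  exact: vect_deg_sbracket.
apply: (sbracket_jacobi_mem DX DX' uX).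
  have := cartan_sbracket_const DC' uX; case: q e {DC' DX'} => [|q] e h.
    rewrite cartan_const in h; rewrite addn0 in e.
    by rewrite e in DC; apply: cartan_sbracket_const DC h.
  by apply: (IH _ _ _ _ _ DC h); move: e; rewrite addnS => -[].
have := cartan_sbracket_const DC uX; case: p e {DC DX} => [|p] e h.
  rewrite cartan_const in h; rewrite add0n in e; rewrite e in DC' DX'.
  by apply: (sbracket_sym_mem DX' h); apply: cartan_sbracket_const DC' h.
by apply: (IH _ _ _ _ _ h DC'); move: e; rewrite addSn => -[].
Qed.

Variables (W s0 : {vspace E}).
Hypotheses (WX : (W <= X 0)%VS) (s0C : (s0 <= C 1)%VS).
Hypotheses (s0s0 : (brspan s0 s0 <= s0)%VS) (s0W : (brspan s0 W <= W)%VS).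

Local Notation S := (prolong_comp cartan W s0).

Lemma prolong_comp_sub k : (S k <= C k.+1)%VS.
Proof. by case: k => [|k] //=; rewrite [_.+2%:Z - 1]degS capvSl. Qed.

Lemma prolong_compS k D :
  D \in S k.+1 <-> D \in C k.+2 /\ {in W, forall w, sbracket D w \in S k}.
Proof.
rewrite [k.+2%:Z - 1]degS memv_cap.
by split=> [/andP[-> /bracket_intoP]|[-> /bracket_intoP]].
Qed.

Lemma prolong_comp_big k : (n <= k)%N -> S k = 0%VS.
Proof.
move=> nk; apply/eqP; rewrite -subv0; apply/subvP => D /(subvP (prolong_comp_sub _)).
by move=> /(subvP (cartan_sub _)) /vect_deg_big ->; rewrite ?mem0v.
Qed.

(** Prolongs are closed under the bracket: apply the Jacobi identity to the
    bracket with W and descend. *)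
Lemma prolong_sbracket j k D D' : D \in S j -> D' \in S k -> sbracket D D' \in S (j + k)%N.
Proof.
move: {-1}(j + k)%N (erefl (j + k)%N) => m; elim: m j k D D' => [|m IH] j k D D' e DS DS'.
  have [j0 k0] : j = 0%N /\ k = 0%N by move: j k e {DS DS'} => [] // [].
  by rewrite {}j0 {}k0 in DS DS'; apply: (subvP s0s0); apply: brspan_mem.
have DC := subvP (prolong_comp_sub _) _ DS; have DC' := subvP (prolong_comp_sub _) _ DS'.
have DX := subvP (cartan_sub _) _ DC; have DX' := subvP (cartan_sub _) _ DC'.
apply/prolong_compS; split=> [|w wW]; first by rewrite -e; apply: cartan_sbracket.
have wX := subvP WX _ wW; apply: (sbracket_jacobi_mem DX DX' wX).
  case: k e DS' {DC' DX'} => [|k] e DS'.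
    have w'W : sbracket D' w \in W by apply: (subvP s0W); apply: brspan_mem.
    by rewrite addn0 in e; rewrite e in DS; case/prolong_compS: DS => _; apply.
  case/prolong_compS: DS' => _ /(_ _ wW) h; apply: (IH _ _ _ _ _ DS h).
  by move: e; rewrite addnS => -[].
case: j e DS {DC DX} => [|j] e DS.
  have w'W : sbracket D w \in W by apply: (subvP s0W); apply: brspan_mem.
  apply: (sbracket_sym_mem DX' (subvP WX _ w'W)).
  by rewrite add0n in e; rewrite e in DS'; case/prolong_compS: DS' => _; apply.
case/prolong_compS: DS => _ /(_ _ wW) h; apply: (IH _ _ _ _ _ h DS').
by move: e; rewrite addSn => -[].
Qed.

Lemma brspan_addl U U' Z Z' :
  (brspan U Z <= Z')%VS -> (brspan U' Z <= Z')%VS -> (brspan (U + U') Z <= Z')%VS.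
Proof.
move=> /brspanP h /brspanP h'; apply/brspanP => D D' /memv_addP[u uU [u' uU' ->]] DZ.
by rewrite sbracketDl; apply: memvD; [apply: h | apply: h'].
Qed.

Lemma brspan_addr U U' Z Z' :
  (brspan Z U <= Z')%VS -> (brspan Z U' <= Z')%VS -> (brspan Z (U + U') <= Z')%VS.
Proof.
move=> /brspanP h /brspanP h'; apply/brspanP => D D' DZ /memv_addP[u uU [u' uU' ->]].
by rewrite sbracketDr; apply: memvD; [apply: h | apply: h'].
Qed.

Lemma brspan_sums (I J : finType) (P : pred I) (Q : pred J) (U : I -> {vspace E})
    (V : J -> {vspace E}) Z :
  (forall i j, P i -> Q j -> brspan (U i) (V j) <= Z)%VS ->
  (brspan (\sum_(i | P i) U i) (\sum_(j | Q j) V j) <= Z)%VS.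
Proof.
move=> h.
have h1 i : P i -> (brspan (U i) (\sum_(j | Q j) V j) <= Z)%VS.
  move=> Pi; elim/big_rec: _ => [|j Y Qj]; last by apply: brspan_addr; apply: h.
  by apply/brspanP => D D' _; rewrite memv0 => /eqP->; rewrite sbracket0r mem0v.
elim/big_rec: _ => [|i Y Pi]; last by apply: brspan_addl; apply: h1.
by apply/brspanP => D D'; rewrite memv0 => /eqP->; rewrite sbracket0l mem0v.
Qed.

Lemma brspan_sym p q U V Z : (U <= X p)%VS -> (V <= X q)%VS ->
  (brspan U V <= Z)%VS -> (brspan V U <= Z)%VS.
Proof.
move=> UX VX /brspanP h; apply/brspanP => D D' DV DU.
by apply: (sbracket_sym_mem (subvP UX _ DU) (subvP VX _ DV)); apply: h.
Qed.

Definition tail r : {vspace E} := (\sum_(k < n.+1 | (r <= k)%N) S k)%VS.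

Lemma tail_sup r k : (r <= k)%N -> (S k <= tail r)%VS.
Proof.
move=> rk; have [kn|nk] := ltnP k n.+1; last by rewrite prolong_comp_big ?sub0v // ltnW.
by apply: (sumv_sup (Ordinal kn)).
Qed.

Lemma tail_nilpotent r : (0 < r)%N -> (brspan (tail r) (tail r) <= tail r.+1)%VS.
Proof.
move=> r0; apply: brspan_sums => i j ri rj; apply: subv_trans (_ : S (i + j) <= _)%VS.
  by apply/brspanP => D D'; apply: prolong_sbracket.
by apply: tail_sup; rewrite -addn1 leq_add // (leq_trans r0).
Qed.

Lemma stable_line T A v : (T <= bracket_into A A)%VS ->
  (T <= bracket_into <[v]> (A + <[v]>))%VS -> (T <= bracket_into (A + <[v]>) (A + <[v]>))%VS.
Proof.
move=> TA Tv; apply/subvP => z zT; apply/bracket_intoP => u /line_addP[k hk].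
rewrite -[u](subrK (k *: v)) sbracketDr sbracketZr; apply: memvD.
  by apply: (subvP (addvSl _ _)); have /(subvP TA)/bracket_intoP := zT; apply.
by apply: memvZ; rewrite -bracket_into_line (subvP Tv).
Qed.

(** Climb from 0 by Lie's theorem: the last step before U gives the hyperplane. *)
Lemma stable_hyperplane T U : lie_solvable T -> (brspan T T <= T)%VS ->
  (T <= X 1)%VS -> (U <= X 0)%VS -> (T <= bracket_into U U)%VS -> U != 0%VS ->
  exists A v, [/\ (A <= U)%VS, v \in U, v \notin A & (U <= A + <[v]>)%VS] /\
    ((T <= bracket_into A A) && (T <= bracket_into <[v]> (A + <[v]>)))%VS.
Proof.
move=> sT TT TX UX TU U0.
suff climb m : forall A, (\dim U < m + \dim A)%N -> (A <= U)%VS -> A != U ->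
    (T <= bracket_into A A)%VS -> exists A v,
    [/\ (A <= U)%VS, v \in U, v \notin A & (U <= A + <[v]>)%VS] /\
    ((T <= bracket_into A A) && (T <= bracket_into <[v]> (A + <[v]>)))%VS.
  apply: (climb (\dim U).+1 0%VS); rewrite ?dimv0 ?addn0 ?sub0v // 1?eq_sym //.
  by apply/subvP => z _; apply/bracket_intoP => u; rewrite memv0 => /eqP->; rewrite sbracket0r mem0v.
elim: m => [|m IH] A dA AU nAU TA; first by rewrite ltnNge dimvS in dA.
have [v [vU vA Tv]] := lie_eigenvector Ksplit K0 sT TT TX AU UX nAU TA TU.
have sub : (A + <[v]> <= U)%VS by rewrite subv_add AU -memvE.
have [e|ne] := eqVneq (A + <[v]>)%VS U.
  by exists A, v; rewrite TA Tv e subvv.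
apply: (IH (A + <[v]>)%VS) => //; last exact: stable_line.
apply: leq_trans dA _; rewrite addSnnS leq_add2l ltn_neqAle dimvS ?addvSl // andbT.
apply: contra vA => /eqP eA.
have /eqP -> : A == (A + <[v]>)%VS by rewrite eqEdim addvSl eA /=.
by apply: (subvP (addvSr _ _)); apply: memv_line.
Qed.

(** Constant fields commute, so [[u, D], v] is antisymmetric in u and v. *)
Lemma sbracket_swap u v D : u \in X 0 -> v \in X 0 -> D \in X 2 ->
  sbracket (sbracket u D) v = - sbracket (sbracket v D) u.
Proof.
move=> uX vX DX; have pu := vect_deg_parity uX; have pv := vect_deg_parity vX.
have pD := vect_deg_parity DX.
rewrite (jacobi pu pD pv) (const_sbracket uX vX) sbracket0l scaler0 addr0.
have -> : sbracket D v = sbracket v D by rewrite (sbracketC pD pv) /= opprK scale1r.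
by rewrite (sbracketC pu (has_parity_sbracket pv pD)) /= scaleN1r.
Qed.

(** If T acts on U with [T, U] = U, then the scalar by which T acts on U modulo a
    stable hyperplane A is not zero; but it vanishes on [T, T], and on [U, P] by
    antisymmetry. *)
Lemma perfect_module_eq0 T U P : lie_solvable T -> (brspan T T <= T)%VS ->
  (T <= X 1)%VS -> (U <= X 0)%VS -> (P <= X 2)%VS -> (brspan U P <= T)%VS ->
  (brspan T U <= U)%VS -> (U <= brspan T U)%VS ->
  (T <= brspan T T + brspan U P)%VS -> U = 0%VS.
Proof.
move=> sT TT TX UX PX UP TU UTU gT; apply/eqP; apply: contraT => U0.
have stU : (T <= bracket_into U U)%VS.
  by apply/subvP => z zT; apply/bracket_intoP => u uU; apply: (subvP TU); apply: brspan_mem.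
have [A [v [[AU vU vA UAv] /andP[TA Tv]]]] := stable_hyperplane sT TT TX UX stU U0.
have vX := subvP UX _ vU.
have TvA : (T <= bracket_into <[v]> A)%VS.
  apply: subv_trans gT _; rewrite subv_add.
  rewrite (commutators_kill TX (subv_trans AU UX)) //=.
  apply/brspanP => u D uU DP; rewrite bracket_into_line.
  have DX := subvP PX _ DP.
  have vDT : sbracket v D \in T by apply: (subvP UP); apply: brspan_mem.
  have vv : sbracket (sbracket v D) v = 0.
    have := sbracket_swap vX vX DX; move: (sbracket _ v) => w /eqP.
    rewrite -addr_eq0 -mulr2n -scaler_nat scaler_eq0 (negPf (K0 1)) /= => /eqP; exact.
  have /line_addP[k hk] := subvP UAv _ uU.
  have [a [aA ->]] : exists a, a \in A /\ u = a + k *: v.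
    by exists (u - k *: v); rewrite subrK.
  rewrite !sbracketDl !sbracketZl vv scaler0 addr0.
  have uX : a \in X 0 by apply: (subvP UX); apply: (subvP AU).
  rewrite (sbracket_swap uX vX DX) memvN.
  by have /(subvP TA)/bracket_intoP := vDT; apply.
suff : v \in A by rewrite (negPf vA).
apply: (subvP _ _ vU); apply: subv_trans UTU _; apply/brspanP => z u zT uU.
have /line_addP[k hk] := subvP UAv _ uU.
rewrite -[u](subrK (k *: v)) sbracketDr sbracketZr; apply: memvD.
  by have /(subvP TA)/bracket_intoP := zT; apply.
by apply: memvZ; rewrite -bracket_into_line (subvP TvA).
Qed.

(** Upper bounds for the components of degrees -1 and 0 of the derived series. *)
Fixpoint derived_bound i : {vspace E} * {vspace E} :=
  if i is i'.+1 then
    let: (U, T) := derived_bound i' in (brspan T U, brspan T T + brspan U (S 1))%VS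
  else (W, s0).

Lemma prolong1_vect : (S 1 <= X 2)%VS.
Proof. exact: subv_trans (prolong_comp_sub 1) (cartan_sub 2). Qed.

Lemma s0_vect : (s0 <= X 1)%VS.
Proof. exact: subv_trans s0C (cartan_sub 1). Qed.

Lemma derived_bound_decr i :
  ((derived_bound i.+1).1 <= (derived_bound i).1)%VS /\
  ((derived_bound i.+1).2 <= (derived_bound i).2)%VS.
Proof.
elim: i => [|i]; last first.
  rewrite [derived_bound i.+2]/= [derived_bound i.+1]/=.
  case: (derived_bound i) => U T /= [hU hT].
  by rewrite !brspanS // addvS // brspanS.
split; rewrite //= subv_add s0s0 /=.
apply: (brspan_sym prolong1_vect WX); apply/brspanP => D w /prolong_compS[_]; exact.
Qed.

Lemma derived_bound_le i : ((derived_bound i).1 <= W)%VS /\ ((derived_bound i).2 <= s0)%VS.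
Proof.
elim: i => [|i [hU hT]]; first by split.
by have [h1 h2] := derived_bound_decr i; split; [apply: subv_trans hU | apply: subv_trans hT].
Qed.

(** Both components decrease, so the sum of their dimensions stops decreasing. *)
Lemma derived_bound_stable : exists i, derived_bound i.+1 = derived_bound i.
Proof.
pose f i := (\dim (derived_bound i).1 + \dim (derived_bound i).2)%N.
suff [i hi] : exists i, (f i <= f i.+1)%N.
  have [hU hT] := derived_bound_decr i; exists i.
  have := dimvS hU; have := dimvS hT; rewrite /f in hi => d2 d1.
  have e1 : \dim (derived_bound i.+1).1 = \dim (derived_bound i).1 by lia.
  have e2 : \dim (derived_bound i.+1).2 = \dim (derived_bound i).2 by lia.
  have /eqP q1 : (derived_bound i.+1).1 == (derived_bound i).1 by rewrite eqEdim hU e1 /=.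
  have /eqP q2 : (derived_bound i.+1).2 == (derived_bound i).2 by rewrite eqEdim hT e2 /=.
  by rewrite [LHS]surjective_pairing [RHS]surjective_pairing q1 q2.
have [/existsP[i hi]|/existsPn h] := boolP [exists i : 'I_(f 0).+1, (f i <= f i.+1)%N]; first by exists i.
suff h' i : (i <= (f 0).+1)%N -> (f i + i <= f 0)%N.
  by have := h' _ (leqnn _); rewrite addnS ltnNge leq_addl.
elim: i => [|i IH] hi; first by rewrite addn0.
have := h (Ordinal hi); rewrite /= -ltnNge => lt.
by apply: leq_trans (IH (ltnW hi)); rewrite addnS ltn_add2r.
Qed.

Definition full_prolong : {vspace E} := (W + tail 0)%VS.

Lemma tail0 : (tail 0 <= s0 + tail 1)%VS.
Proof.
apply/subv_sumP => -[[|k] /= kn] _; first exact: addvSl.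
by apply: subv_trans (addvSr _ _); apply: (@tail_sup 1 k.+1).
Qed.

Lemma derived_le_bound i :
  (derived full_prolong i <= (derived_bound i).1 + (derived_bound i).2 + tail 1)%VS.
Proof.
elim: i => [|i IH]; first by rewrite /= -addvA addvS // tail0.
apply: subv_trans (brspanS IH IH) _.
have := derived_bound_le i; rewrite [derived_bound i.+1]/=.
case: (derived_bound i) => U T /= [UW Ts0].
have UX := subv_trans UW WX; have TX := subv_trans Ts0 s0_vect.
set R := (X in (_ <= X)%VS).
have TU : (brspan T U <= R)%VS by rewrite /R -addvA addvSl.
have TT : (brspan T T <= R)%VS.
  by rewrite /R; apply: subv_trans (addvSl _ _); apply: subv_trans (addvSr _ _); apply: addvSl.
have UP : (brspan U (S 1) <= R)%VS.
  by rewrite /R; apply: subv_trans (addvSl _ _); apply: subv_trans (addvSr _ _); apply: addvSr.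
have tR : (tail 1 <= R)%VS by exact: addvSr.
have UU : (brspan U U <= R)%VS.
  apply/brspanP => u v /(subvP UX) uX /(subvP UX) vX.
  by rewrite (const_sbracket uX vX) mem0v.
have SX k : (S k <= X k.+1)%VS := subv_trans (prolong_comp_sub k) (cartan_sub _).
have Sk0 k : (0 < k)%N -> (brspan T (S k) <= R)%VS.
  move=> k0; apply: subv_trans tR; apply: subv_trans (tail_sup k0).
  by apply/brspanP => D D' /(subvP Ts0) DT D'S; apply: (@prolong_sbracket 0 k).
have Ukk k : (0 < k)%N -> (brspan U (S k) <= R)%VS.
  case: k => [//|[//|k]] _; apply: (brspan_sym (SX _) UX).
  apply: subv_trans tR; apply: subv_trans (@tail_sup 1 k.+1 isT).
  by apply/brspanP => D u /prolong_compS[_ h] /(subvP UW); apply: h.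
have big1 (V : {vspace E}) Y : (forall k, (0 < k)%N -> (brspan V (S k) <= Y)%VS) ->
    (brspan V (tail 1) <= Y)%VS.
  move=> h; rewrite /tail; elim/big_rec: _ => [|k Z k0 hZ]; last by apply: brspan_addr; rewrite ?h.
  by apply/brspanP => D D' _; rewrite memv0 => /eqP->; rewrite sbracket0r mem0v.
have big2 (V : {vspace E}) Y : (forall k, (0 < k)%N -> (brspan (S k) V <= Y)%VS) ->
    (brspan (tail 1) V <= Y)%VS.
  move=> h; rewrite /tail; elim/big_rec: _ => [|k Z k0 hZ]; last by apply: brspan_addl; rewrite ?h.
  by apply/brspanP => D D'; rewrite memv0 => /eqP->; rewrite sbracket0l mem0v.
apply: brspan_addl; [apply: brspan_addl|]; (apply: brspan_addr; [apply: brspan_addr|]) => //.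
- exact: brspan_sym TX UX TU.
- exact: big1.
- exact: big1.
- by apply: big2 => k k0; apply: (brspan_sym UX (SX k)); apply: Ukk.
- by apply: big2 => k k0; apply: (brspan_sym TX (SX k)); apply: Sk0.
apply: subv_trans (@tail_nilpotent 1 isT) _; apply: subv_trans tR.
by apply/subv_sumP => k k1; apply: tail_sup; apply: ltnW.
Qed.

Lemma derived_add U i j : derived U (i + j) = derived (derived U i) j.
Proof. by elim: j => [|j IH]; rewrite ?addn0 // addnS /= IH. Qed.

Lemma tail_solvable : lie_solvable (tail 1).
Proof.
exists n; apply/eqP; rewrite -subv0.
have h k : (derived (tail 1) k <= tail k.+1)%VS.
  elim: k => //= k IH; apply: subv_trans (brspanS IH IH) _; exact: tail_nilpotent.
apply: subv_trans (h n) _; apply/subv_sumP => k nk.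
by have := ltn_ord k; rewrite ltnNge nk.
Qed.

Lemma prolong_solvable : lie_solvable s0 -> lie_solvable full_prolong.
Proof.
move=> ss0; have [i st] := derived_bound_stable.
have := derived_le_bound i; have := derived_bound_le i.
have := derived_bound_decr i; rewrite st; move: st; rewrite [derived_bound i.+1]/=.
case: (derived_bound i) => U T [eU eT] /= _ [UW Ts0] h.
have UX := subv_trans UW WX; have TX := subv_trans Ts0 s0_vect.
have sT := solvableS Ts0 ss0.
have TT : (brspan T T <= T)%VS by rewrite -{3}eT addvSl.
have U0 : U = 0%VS.
  apply: (@perfect_module_eq0 T U (S 1)) => //; rewrite ?prolong1_vect ?eU ?eT ?subvv //.
  by rewrite -eT addvSr.
have T0 : T = 0%VS.
  have b0 : brspan U (S 1) = 0%VS.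
    apply/eqP; rewrite -subv0 U0; apply/brspanP => D D'.
    by rewrite memv0 => /eqP-> _; rewrite sbracket0l mem0v.
  rewrite b0 addv0 in eT; have [k dk] := sT.
  by rewrite -dk; elim: k {dk} => //= k <-.
rewrite U0 T0 !add0v in h; have [j hj] := tail_solvable.
exists (i + j)%N; apply/eqP; rewrite derived_add -subv0 -hj; exact: derivedS.
Qed.

End Prolong.

(** * Consequences of the maximality of s0 *)

Section Maximality.
Variables (K : fieldType) (n : nat).
Hypotheses (Ksplit : split_polys K) (K0 : char_zero K).
Variable s : bool.
Local Notation E := 'End(grassmann K n).
Local Notation H p := (homog K n p%:Z).
Local Notation X p := (vect_deg K n (p%:Z - 1)).
Local Notation divergence := (@divergence K n).
Local Notation G := (cartan K n s).
Local Notation C p := (component G (p%:Z - 1)).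
Local Notation euler := (euler K n).
Implicit Types (A B T U Z : {vspace E}) (D u v w x y : E).

Lemma op_part_mem p a Z D : (Z <= X p)%VS -> D \in Z -> op_part a D \in Z.
Proof.
move=> ZX DZ; have pD := vect_deg_parity (subvP ZX _ DZ).
have [->|ne] := eqVneq a (~~ odd p); first by rewrite op_part_id.
by rewrite (_ : a = ~~ ~~ odd p) ?op_part0 ?mem0v //; move: ne; case: a; case: (odd p).
Qed.

Variables (W s0 : {vspace E}).
Hypotheses (WX : (W <= X 0)%VS) (W0 : W != 0%VS).
Hypothesis hmax : maximal_solvable_preserving G W s0.

Local Notation S := (prolong_comp G W s0).

Lemma max_sub : (s0 <= C 1)%VS.
Proof. by case: hmax => [[[]]]. Qed.
Lemma max_closed : (brspan s0 s0 <= s0)%VS.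
Proof. by case: hmax => [[[]]]. Qed.
Lemma max_stable : (brspan s0 W <= W)%VS.
Proof. by case: hmax => [[]]. Qed.
Lemma max_solvable : lie_solvable s0.
Proof. by case: hmax => [[]]. Qed.
Lemma max_sub_vect : (s0 <= X 1)%VS.
Proof. exact: subv_trans max_sub (cartan_sub _ _ _ _). Qed.

Lemma max_absorb T : (T <= C 1)%VS -> lie_solvable T -> (brspan T T <= T)%VS ->
  (brspan T W <= W)%VS -> (s0 <= T)%VS -> T = s0.
Proof.
move=> TC sT TT TW s0T; case: hmax => _; apply=> //; split=> //; split=> // a D.
by apply: op_part_mem; apply: subv_trans TC (cartan_sub _ _ _ _).
Qed.

Section Absorb.
Variable v : E.
Hypotheses (vX : v \in X 0) (sv : (s0 <= bracket_into <[v]> (W + <[v]>))%VS).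
Let U := (W + <[v]>)%VS.

(** The bracket of the Euler field with a constant field u is - u, so the last
    condition says that D acts on X 0 / U by a scalar. *)
Definition ideal : {vspace E} :=
  (C 1 :&: bracket_into W 0 :&: bracket_into U U
   :&: (bracket_into (X 0) U + <[euler]>))%VS.

Lemma UX : (U <= X 0)%VS.
Proof. by rewrite subv_add WX -memvE. Qed.

Lemma idealP D : reflect
  [/\ D \in C 1, {in W, forall w, sbracket D w = 0}, {in U, forall u, sbracket D u \in U}
    & exists a, {in X 0, forall u, sbracket D u + a *: u \in U}]
  (D \in ideal).
Proof.
have key a : (D - a *: euler \in bracket_into (X 0) U) <->
    {in X 0, forall u, sbracket D u + a *: u \in U}.
  have e u : u \in X 0 -> sbracket (D - a *: euler) u = sbracket D u + a *: u.
    by move=> uX; rewrite sbracketBl sbracketZl (euler_const uX) scalerN opprK.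
  by split=> [/bracket_intoP h u uX|h]; [rewrite -e ?h | apply/bracket_intoP => u uX; rewrite e ?h].
rewrite /ideal !memv_cap -!andbA.
apply: (iffP and4P) => -[DC DW DU DV]; split=> //.
- by move=> w wW; apply/eqP; rewrite -memv0; apply: (bracket_intoP _ _ _ DW).
- exact: (bracket_intoP _ _ _ DU).
- by case/line_addP: DV => a /key h; exists a.
- by apply/bracket_intoP => w wW; rewrite DW ?mem0v.
- exact/bracket_intoP.
by apply/line_addP; have [a /key h] := DV; exists a.
Qed.

Lemma ideal_vect D : D \in ideal -> D \in X 1.
Proof. by case/idealP => /(subvP (cartan_sub _ _ _ _)). Qed.

Lemma vect0_const D u : D \in X 1 -> u \in X 0 -> sbracket D u \in X 0.
Proof. exact: vect_deg_sbracket. Qed.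

Lemma s0_stable_flag D u : D \in s0 -> u \in U -> sbracket D u \in U.
Proof.
move=> Ds; have h : (s0 <= bracket_into W W)%VS.
  by apply/subvP => x xs; apply/bracket_intoP => w wW; apply: (subvP max_stable); apply: brspan_mem.
by have /bracket_intoP := subvP (stable_line h sv) _ Ds; apply.
Qed.

Lemma s0_ideal D D' : D \in s0 -> D' \in ideal -> sbracket D D' \in ideal.
Proof.
move=> Ds /idealP[D'C D'W D'U [a D'V]].
have DC := subvP max_sub _ Ds; have DX := subvP max_sub_vect _ Ds.
have D'X := subvP (cartan_sub _ _ _ _) _ D'C.
apply/idealP; split.
- exact: (@cartan_sbracket _ _ _ 0 0).
- move=> w wW; rewrite (jacobi_const DX D'X (subvP WX _ wW)) D'W // sbracket0r D'W ?subr0 //.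
  by apply: (subvP max_stable); apply: brspan_mem.
- move=> u uU; rewrite (jacobi_const DX D'X (subvP UX _ uU)).
  by apply: memvB; [apply: s0_stable_flag => //; apply: D'U | apply: D'U; apply: s0_stable_flag].
exists 0 => u uX; rewrite scale0r addr0 (jacobi_const DX D'X uX).
have DuX := vect0_const DX uX.
rewrite -(cancel_right _ _ (- a *: sbracket D u)) ![- a *: _]scaleNr !opprK.
apply: memvB; last exact: D'V.
rewrite -sbracketZr -sbracketDr; apply: s0_stable_flag => //; exact: D'V.
Qed.

Lemma ideal_derived : (brspan ideal ideal <=
  X 1 :&: bracket_into (X 0) U :&: bracket_into U W :&: bracket_into W 0)%VS.
Proof.
rewrite !subv_cap -!andbA; apply/and4P; split.
- by apply/brspanP => D D' /ideal_vect h /ideal_vect h'; apply: (@vect_deg_sbracket _ _ 1 1).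
- apply/brspanP => D D' Di Di'; apply/bracket_intoP => u uX.
  have DX := ideal_vect Di; have DX' := ideal_vect Di'.
  case/idealP: Di => _ _ DU [a DV]; case/idealP: Di' => _ _ DU' [a' DV'].
  rewrite (jacobi_const DX DX' uX).
  have key x y b c : {in U, forall u, sbracket x u \in U} -> sbracket y u + c *: u \in U ->
      sbracket x u + b *: u \in U -> sbracket x (sbracket y u) - (c * b) *: u \in U.
    move=> xU yu xu; have := xU _ yu; rewrite sbracketDr sbracketZr => h.
    have := memvB h (memvZ c xu); congr (is_true (_ \in U)).
    move: (sbracket x (sbracket y u)) (sbracket x u) => p q.
    by rewrite scalerDr scalerA opprD addrA addrK.
  have := memvB (key _ _ _ _ DU (DV' _ uX) (DV _ uX)) (key _ _ _ _ DU' (DV _ uX) (DV' _ uX)).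
  by rewrite [a * a']mulrC cancel_right.
- have iX : (ideal <= X 1)%VS by apply/subvP => D /ideal_vect.
  have kill : (brspan ideal ideal <= bracket_into <[v]> W)%VS.
    apply: commutators_kill => //.
      apply/subvP => D /idealP[_ DW _ _]; apply/bracket_intoP => w wW.
      by rewrite DW ?mem0v.
    apply/subvP => D /idealP[_ _ DU _]; rewrite bracket_into_line; apply: DU.
    by apply: (subvP (addvSr _ _)); apply: memv_line.
  apply/brspanP => D D' Di Di'; apply/bracket_intoP => u /line_addP[k hk].
  have DX := ideal_vect Di; have DX' := ideal_vect Di'.
  rewrite -[u](subrK (k *: v)) sbracketDr sbracketZr; apply: memvD; last first.
    by apply: memvZ; rewrite -bracket_into_line (subvP kill) ?brspan_mem.
  case/idealP: Di => _ DW _ _; case/idealP: Di' => _ DW' _ _.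
  by rewrite (jacobi_const DX DX' (subvP WX _ hk)) (DW _ hk) (DW' _ hk) !sbracket0r subrr mem0v.
apply/brspanP => D D' Di Di'; apply/bracket_intoP => w wW.
have DX := ideal_vect Di; have DX' := ideal_vect Di'.
case/idealP: Di => _ DW _ _; case/idealP: Di' => _ DW' _ _.
by rewrite (jacobi_const DX DX' (subvP WX _ wW)) (DW _ wW) (DW' _ wW) !sbracket0r subrr mem0v.
Qed.

Lemma brspan_flag T A A' B : (T <= X 1)%VS -> (A <= X 0)%VS ->
  (T <= bracket_into A A')%VS -> (T <= bracket_into A' B)%VS ->
  (brspan T T <= bracket_into A B)%VS.
Proof.
move=> TX AX TA TA'; apply/brspanP => D D' DT DT'; apply/bracket_intoP => u uA.
rewrite (jacobi_const (subvP TX _ DT) (subvP TX _ DT') (subvP AX _ uA)).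
have h x y : x \in T -> y \in T -> sbracket x (sbracket y u) \in B.
  move=> /(subvP TA')/bracket_intoP hx /(subvP TA)/bracket_intoP hy.
  by apply: hx; apply: hy.
by apply: memvB; apply: h.
Qed.

(** The first derived algebra moves X 0 into U, U into W and W to 0; two more steps
    kill X 0, which acts faithfully. *)
Lemma ideal_solvable : lie_solvable ideal.
Proof.
pose T1 := brspan ideal ideal; pose T2 := brspan T1 T1.
have := ideal_derived; rewrite -/T1 !subv_cap -!andbA => /and4P[X1 V1 U1 W1].
have X2 : (T2 <= X 1)%VS.
  apply/brspanP => D D' /(subvP X1) h /(subvP X1) h'; exact: (@vect_deg_sbracket _ _ 1 1).
have V2 : (T2 <= bracket_into (X 0) W)%VS by apply: brspan_flag X1 _ V1 U1.
have U2 : (T2 <= bracket_into U 0)%VS by apply: brspan_flag X1 UX U1 W1.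
have V3 : (brspan T2 T2 <= bracket_into (X 0) 0)%VS.
  by apply: brspan_flag X2 _ V2 _ => //; apply: subv_trans U2 (bracket_intoS (addvSl _ _) (subvv _)).
exists 3; apply/eqP; rewrite -subv0; apply/subvP => D DT; rewrite memv0; apply/eqP.
apply: (@vect_deg_faithful _ _ 0).
  have /brspanP h : (brspan T2 T2 <= X 1)%VS.
    by apply/brspanP => x y /(subvP X2) h /(subvP X2) h'; exact: (@vect_deg_sbracket _ _ 1 1).
  by apply: (subvP _ _ DT); apply/brspanP.
move=> u uX; apply/eqP; rewrite -memv0.
by have /bracket_intoP := subvP V3 _ DT; apply.
Qed.

Lemma ideal_closed : (brspan ideal ideal <= ideal)%VS.
Proof.
apply/brspanP => D D' Di Di'.
have h := subvP ideal_derived _ (brspan_mem Di Di'); rewrite !memv_cap -!andbA in h.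
case/and4P: h => _ /bracket_intoP hV /bracket_intoP hU /bracket_intoP hW.
apply/idealP; split.
- case/idealP: Di => DC _ _ _; case/idealP: Di' => DC' _ _ _.
  exact: (@cartan_sbracket _ _ _ 0 0).
- by move=> w wW; apply/eqP; rewrite -memv0; apply: hW.
- by move=> u uU; apply: hV; apply: (subvP UX).
by exists 0 => u uX; rewrite scale0r addr0; apply: hV.
Qed.

(** s0 + ideal is solvable and preserves W. *)
Lemma ideal_sub_max : (ideal <= s0)%VS.
Proof.
have iX : (ideal <= X 1)%VS by apply/subvP => D /ideal_vect.
have si : (brspan s0 ideal <= ideal)%VS by apply/brspanP => D D'; apply: s0_ideal.
have is_ : (brspan ideal s0 <= ideal)%VS by apply: brspan_sym max_sub_vect iX si.
suff <- : (s0 + ideal)%VS = s0 by exact: addvSr.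
have [k dk] := max_solvable; have [l dl] := ideal_solvable.
have der i : (derived s0 i <= s0)%VS.
  elim: i => //= i IH; apply: subv_trans (brspanS IH IH) max_closed.
apply: max_absorb; last exact: addvSl.
- rewrite subv_add max_sub; apply/subvP => D; by case/idealP.
- have h i : (derived (s0 + ideal) i <= derived s0 i + ideal)%VS.
    elim: i => //= i IH; apply: subv_trans (brspanS IH IH) _.
    have iR Z : (Z <= ideal)%VS -> (Z <= brspan (derived s0 i) (derived s0 i) + ideal)%VS.
      by move=> h; apply: subv_trans h (addvSr _ _).
    apply: brspan_addl; apply: brspan_addr; first exact: addvSl.
    + by apply: iR; apply: subv_trans (brspanS (der i) (subvv _)) si.
    + by apply: iR; apply: subv_trans (brspanS (subvv _) (der i)) is_.
    by apply: iR; apply: ideal_closed.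
  exists (k + l)%N; apply/eqP; rewrite derived_add -subv0 -dl; apply: derivedS.
  by have := h k; rewrite dk add0v.
- apply: brspan_addl; apply: brspan_addr.
  + exact: subv_trans max_closed (addvSl _ _).
  + exact: subv_trans si (addvSr _ _).
  + exact: subv_trans is_ (addvSr _ _).
  exact: subv_trans ideal_closed (addvSr _ _).
apply: brspan_addl; first exact: max_stable.
by apply/brspanP => D w /idealP[_ h _ _] wW; rewrite h ?mem0v.
Qed.

End Absorb.

Lemma nilradical_sub f w : f \in H 1 -> {in W, forall w', w' f = 0} -> w \in W ->
  fmul f w \in s0.
Proof.
move=> fH fW wW; have wX := subvP WX _ wW.
have fwX : fmul f w \in X 1 := fmul_vect fH wX.
have sv : (s0 <= bracket_into <[0]> (W + <[0]>))%VS.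
  by apply/subvP => D _; rewrite bracket_into_line sbracket0r mem0v.
apply: (subvP (ideal_sub_max (mem0v _) sv)).
have br0 u : u \in W -> sbracket (fmul f w) u = 0.
  by move=> uW; rewrite (sbracket_rank1 fH wX (subvP WX _ uW) (k := 0)) ?scale0r ?fW // oppr0 scale0r.
have U0 : (W + <[0 : E]>)%VS = W by rewrite (_ : <[0]>%VS = 0%VS) ?addv0 //; apply/eqP; rewrite -subv0 -memvE mem0v.
apply/idealP; split=> //.
- by apply/cartanP; split=> // _; rewrite (div_fmul fH wX) fW // scaler0.
- by move=> u; rewrite U0 => uW; rewrite br0 // mem0v.
exists 0 => u uX; rewrite scale0r addr0 U0.
by rewrite (sbracket_rank1 fH wX uX (const_eval uX fH)) memvZ.
Qed.

(** A solvable T that contains s0 stabilises W: otherwise some x in T moves w in W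
    out of W, and its commutator with a rank one element of the nilradical fixes w. *)
Lemma solvable_above_max T : (T <= C 1)%VS -> lie_solvable T -> (brspan T T <= T)%VS ->
  (s0 <= T)%VS -> T = s0.
Proof.
move=> TC sT TT s0T; apply: max_absorb => //.
have TX := subv_trans TC (cartan_sub _ _ _ _).
apply/brspanP => x w xT wW; apply: contraT => nxw.
have xX := subvP TX _ xT; have wX := subvP WX _ wW.
have xwX : sbracket x w \in X 0 := vect0_const xX wX.
have [f [fH fW fxw]] := exists_form WX xwX nxw.
have yT : fmul f w \in T by apply: (subvP s0T); apply: nilradical_sub.
have e : sbracket (sbracket x (fmul f w)) w = 1 *: w.
  rewrite (jacobi_const xX (subvP TX _ yT) wX).
  rewrite (sbracket_rank1 fH wX wX (k := 0)) ?scale0r ?fW // oppr0 scale0r sbracket0r.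
  by rewrite (sbracket_rank1 fH wX xwX (k := 1)) ?scale1r // sub0r scaleN1r opprK.
have TX0 : (T <= bracket_into (X 0) (X 0))%VS.
  by apply/subvP => z zT; apply/bracket_intoP => u; apply: vect0_const; apply: (subvP TX).
have w0 := commutator_nilpotent Ksplit K0 sT TT TX (subvv _) TX0 xT yT wX e (oner_neq0 _).
by rewrite w0 sbracket0r mem0v in nxw.
Qed.

Lemma max_stable_const : (s0 <= bracket_into (X 0) (X 0))%VS.
Proof.
by apply/subvP => z zs; apply/bracket_intoP => u; apply: vect0_const; apply: (subvP max_sub_vect).
Qed.

Section DegreeMinusOne.
Variable V1 : {vspace E}.
Hypotheses (WV1 : (W <= V1)%VS) (V1X : (V1 <= X 0)%VS).
Hypothesis s0V1 : (brspan s0 V1 <= V1)%VS.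
Hypothesis SV1 : {in S 1 & V1, forall D u, sbracket D u \in s0}.

Lemma prolong1I D : D \in C 2 -> {in W, forall w, sbracket D w \in s0} -> D \in S 1.
Proof. by move=> DC h; apply/prolong_compS. Qed.

Lemma sbracket_quadratic f g w u : f \in H 1 -> g \in H 1 -> w \in X 0 -> u \in X 0 ->
  sbracket (fmul (f * g) w) u = (u f set0 : K) *: fmul g w - (u g set0 : K) *: fmul f w.
Proof.
move=> fH gH wX uX; rewrite (sbracket_fmul_const (homogM fH gH) wX uX).
rewrite const_mul // (homog_sigma fH) /= !expr1 opprK scale1r scaleN1r.
apply/lfunP => h; rewrite add_lfunE opp_lfunE !scale_lfunE !fmulE.
rewrite {1}(const_eval uX fH) {1}(const_eval uX gH) -scalerAl mul1r -scalerAr mulr1.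
by rewrite mulrDl -!scalerAl mulNr scalerN.
Qed.

(** If W is not a line, f (x) w lies in s0 for every w in W and f vanishing on w
    and v: it is a bracket of v with an element of the prolong. *)
Lemma rank1_sub v f w : v \in V1 -> v \notin W -> f \in H 1 -> w \in W ->
  v f = 0 -> w f = 0 -> fmul f w \in s0.
Proof.
move=> vV vW fH wW vf wf; have vX := subvP V1X _ vV; have wX := subvP WX _ wW.
have [g [gH gW gv]] := exists_form WX vX vW.
have e1 : (1 : grassmann K n) set0 = 1 :> K by rewrite -mono_set0 monoE eqxx.
have DX : fmul (f * g) w \in X 2 := fmul_vect (homogM fH gH) wX.
have DS : fmul (f * g) w \in S 1.
  apply: prolong1I => [|u uW].
    apply/cartanP; split=> // _; rewrite (div_fmul (homogM fH gH) wX) const_mul //.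
    by rewrite wf gW // mul0r mulr0 addr0 scaler0.
  rewrite (sbracket_quadratic fH gH wX (subvP WX _ uW)) gW // g0E scale0r subr0.
  by apply: memvZ; apply: nilradical_sub.
have := SV1 DS vV; rewrite (sbracket_quadratic fH gH wX vX) vf gv g0E e1.
by rewrite scale0r sub0r scale1r memvN.
Qed.

(** Two such rank one fields, built from independent w and w' in W, generate a copy
    of sl(2): their commutator has w as an eigenvector. *)
Lemma const_line_case v w w' : v \in V1 -> v \notin W -> w \in W -> w' \in W ->
  w' \notin <[w]>%VS -> w != 0 -> false.
Proof.
move=> vV vW wW wW' nw w0; have vX := subvP V1X _ vV.
have wX := subvP WX _ wW; have wX' := subvP WX _ wW'.
have indep x y : x \in W -> y \in W -> x \notin <[y]>%VS -> x \notin (<[y]> + <[v]>)%VS.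
  move=> xW yW; apply: contra => /line_addP[k /vlineP[c e]].
  have [k0|k0] := eqVneq k 0; first by apply/vlineP; exists c; rewrite -e k0 scale0r subr0.
  case/negP: vW; rewrite -[v]scale1r -(mulVf k0) -scalerA memvZ //.
  by rewrite -[k *: v](subKr x) memvB // e memvZ.
have nw' : w \notin <[w']>%VS.
  apply: contra nw => /vlineP[c e]; have c0 : c != 0.
    by apply: contraNneq w0 => c0; rewrite e c0 scale0r.
  by apply/vlineP; exists c^-1; rewrite e scalerA mulVf // scale1r.
have sub y : y \in W -> (<[y]> + <[v]> <= X 0)%VS.
  by move=> yW; rewrite subv_add -!memvE vX (subvP WX _ yW).
have [f [fH f0 fw]] := exists_form (sub _ wW') wX (indep _ _ wW wW' nw').
have [g [gH g0 gw']] := exists_form (sub _ wW) wX' (indep _ _ wW' wW nw).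
have vin y : v \in (<[y]> + <[v]>)%VS by apply: (subvP (addvSr _ _)); apply: memv_line.
have yin y : y \in (<[y]> + <[v]>)%VS by apply: (subvP (addvSl _ _)); apply: memv_line.
have xs : fmul f w' \in s0 by apply: (rank1_sub vV vW) => //; apply: f0.
have ys : fmul g w \in s0 by apply: (rank1_sub vV vW) => //; apply: g0.
have e : sbracket (sbracket (fmul f w') (fmul g w)) w = -1 *: w.
  rewrite (jacobi_const (fmul_vect fH wX') (fmul_vect gH wX) wX).
  rewrite (sbracket_rank1 gH wX wX (k := 0)) ?scale0r ?(g0 _ (yin w)) // oppr0 scale0r sbracket0r.
  rewrite (sbracket_rank1 fH wX' wX (k := 1)) ?scale1r // scaleN1r sbracketNr.
  by rewrite (sbracket_rank1 gH wX wX' (k := 1)) ?scale1r // !scaleN1r opprK sub0r.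
have nz : -1 != 0 :> K by rewrite oppr_eq0 oner_neq0.
case/eqP: w0; apply: (commutator_nilpotent Ksplit K0 max_solvable max_closed max_sub_vect
  (subvv _) max_stable_const xs ys wX e nz).
Qed.

Lemma sbracket_fmul_euler f u : f \in H 1 -> u \in X 0 ->
  sbracket (fmul f euler) u = (u f set0 : K) *: euler - fmul f u.
Proof.
move=> fH uX; have DX : fmul f euler \in X 2 := fmul_vect fH (euler_vect K n).
apply: (@vect_deg_ext _ _ 1).
- exact: vect_deg_sbracket DX uX.
- apply: memvB; first by apply: memvZ; apply: euler_vect.
  exact: fmul_vect fH uX.
move=> i; rewrite (sbracket_const _ DX uX) add_lfunE opp_lfunE scale_lfunE !fmulE euler_xi.
rewrite /= expr1 opprK scale1r const_mul // (homog_sigma fH) expr1 scaleN1r mulNr.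
by rewrite {1}(const_eval uX fH) -scalerAl mul1r.
Qed.

(** If W is the line of w and v is an eigenvector of s0 in V1 modulo W, then
    D = f E + (1 - n) f g (x) v, with f(w) = g(v) = 1, is divergence-free and in the
    prolong; its bracket with v does not preserve W. *)
Lemma line_case v w : (2 < n)%N -> v \in V1 -> v \notin W -> (W = <[w]>)%VS -> w != 0 ->
  (s0 <= bracket_into <[v]> (W + <[v]>))%VS -> false.
Proof.
move=> n3 vV vW eW w0 sv; have vX := subvP V1X _ vV.
have wW : w \in W by rewrite eW memv_line.
have wX := subvP WX _ wW.
have nwv : w \notin <[v]>%VS.
  apply: contra vW => /vlineP[c e]; have c0 : c != 0.
    by apply: contraNneq w0 => c0; rewrite e c0 scale0r.
  by rewrite -[v]scale1r -(mulVf c0) -scalerA -e memvZ.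
have vline : (<[v]> <= X 0)%VS by rewrite -memvE.
have [f [fH f0 fw]] := exists_form vline wX nwv.
have fv : v f = 0 by apply: f0; apply: memv_line.
have [g [gH gW gv]] := exists_form WX vX vW.
have gw := gW _ wW.
have e1 : (1 : grassmann K n) set0 = 1 :> K by rewrite -mono_set0 monoE eqxx.
have [c ec] : exists c : K, c = 1 - n%:R by exists (1 - n%:R).
pose D := fmul f euler + c *: fmul (f * g) v.
have DX : D \in X 2.
  apply: memvD; first exact: fmul_vect fH (euler_vect K n).
  by apply: memvZ; apply: fmul_vect (homogM fH gH) vX.
have DC : D \in C 2.
  apply/cartanP; split=> // _; rewrite linearD linearZ /= (div_fmul_euler fH) -ec.
  rewrite (div_fmul (homogM fH gH) vX) const_mul // fv gv mul0r add0r mulr1.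
  by rewrite (homog_sigma fH) expr1 scaleN1r expr2 mulrNN mulr1 scale1r scalerN subrr.
have Du u : u \in X 0 -> sbracket D u = (u f set0 : K) *: euler - fmul f u
    + c *: ((u f set0 : K) *: fmul g v - (u g set0 : K) *: fmul f v).
  move=> uX; rewrite sbracketDl sbracketZl (sbracket_fmul_euler fH uX).
  by rewrite (sbracket_quadratic fH gH vX uX).
have Dw : sbracket D w = euler - fmul f w + c *: fmul g v.
  by rewrite (Du _ wX) fw gw e1 g0E !scale1r scale0r subr0.
have Dv : sbracket D v = - (1 + c) *: fmul f v.
  rewrite (Du _ vX) fv gv e1 g0E !scale0r scale1r !sub0r.
  by rewrite [RHS]scaleNr scalerDl scale1r opprD scalerN.
have DS : D \in S 1.
  have hw : sbracket D w \in s0.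
    apply: (subvP (ideal_sub_max vX sv)).
    have HX : sbracket D w \in X 1 by apply: (vect_deg_sbracket DX wX).
    have Hu u : u \in X 0 -> sbracket (sbracket D w) u + 1 *: u =
        (u f set0 : K) *: w - c *: ((u g set0 : K) *: v).
      move=> uX; rewrite Dw sbracketDl sbracketBl sbracketZl (euler_const uX).
      rewrite (sbracket_rank1 fH wX uX (const_eval uX fH)).
      rewrite (sbracket_rank1 gH vX uX (const_eval uX gH)) scale1r.
      by rewrite !scaleNr !opprK scalerN addrC !addrA subrr add0r.
    have Hw : sbracket (sbracket D w) w = 0.
      by apply: (addIr (1 *: w)); rewrite add0r (Hu _ wX) fw gw e1 g0E scale0r scaler0 subr0.
    have inU u : u \in X 0 -> sbracket (sbracket D w) u + 1 *: u \in (W + <[v]>)%VS.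
      move=> uX; rewrite (Hu _ uX); apply: memvB.
        by apply: (subvP (addvSl _ _)); apply: memvZ.
      by apply: (subvP (addvSr _ _)); apply: memvZ; apply: memvZ; apply: memv_line.
    apply/idealP; split; [| | |by exists 1].
    - exact: cartan_sbracket_const DC wX.
    - by move=> u; rewrite eW => /vlineP[k ->]; rewrite sbracketZr Hw scaler0.
    move=> u uU; rewrite -(addrK (1 *: u) (sbracket _ u)).
    by apply: memvB; [apply: inU; apply: (subvP (UX vX)) | rewrite scale1r].
  apply: (prolong1I DC) => u; rewrite eW => /vlineP[k ->].
  by rewrite sbracketZr; apply: memvZ.
have := SV1 DS vV; rewrite Dv => h.
have cn : - (1 + c) != 0.
  have [m em] : exists m, n = (m.+1 + 2)%N by exists (n - 3)%N; rewrite addSnnS subnK.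
  rewrite (_ : - (1 + c) = m.+1%:R) ?K0 // ec [in n%:R]em natrD.
  by ring.
have {}h : fmul f v \in s0.
  by rewrite -[fmul f v]scale1r -(mulVf cn) -scalerA memvZ.
have := subvP max_stable _ (brspan_mem h wW).
rewrite (sbracket_rank1 fH vX wX (k := 1)) ?scale1r // scaleN1r memvN.
by rewrite (negPf vW).
Qed.

(** In the case of a line, Lie's theorem provides the v that [line_case] needs. *)
Lemma degree_minus_one : (2 < n)%N -> V1 = W.
Proof.
move=> n3; apply/eqP; rewrite eq_sym eqEsubv WV1 /=; apply/subvP => v vV; apply: contraT => vW.
have [w wW w0] : exists2 w, w \in W & w != 0.
  by exists (vpick W); rewrite ?memv_pick ?vpick0.
have [/subvP sub|/subvPn[w' wW' nw']] := boolP (W <= <[w]>)%VS; last first.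
  by have := const_line_case vV vW wW wW' nw' w0.
have eW : W = <[w]>%VS by apply/eqP; rewrite eqEsubv -memvE wW andbT; apply/subvP.
have stab Z : (brspan s0 Z <= Z)%VS -> (s0 <= bracket_into Z Z)%VS.
  by move=> h; apply/subvP => x xs; apply/bracket_intoP => u uZ; apply: (subvP h); apply: brspan_mem.
have neq : W != V1 by apply: contraNneq vW => ->.
have [v' [vV' vW' sv']] := lie_eigenvector Ksplit K0 max_solvable max_closed max_sub_vect
  WV1 V1X neq (stab _ max_stable) (stab _ s0V1).
by have := line_case n3 vV' vW' eW w0 sv'.
Qed.

End DegreeMinusOne.
End Maximality.

(** * Maximality of prolongs *)

Section Transport.
Variables (K : fieldType) (n : nat).
Hypotheses (Ksplit : split_polys K) (K0 : char_zero K) (n3 : (2 < n)%N).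
Variable s : bool.
Local Notation E := 'End(grassmann K n).
Local Notation X p := (vect_deg K n (p%:Z - 1)).
Local Notation G := (cartan K n s).
Local Notation C p := (component G (p%:Z - 1)).
Implicit Types (U T Z t : {vspace E}) (D u v w : E).

(* For vect and svect, phi is the identity; for the deformation of svect, it is the
   multiplication by 1 + Xi. *)
Variables (g : graded_vf K n) (phi : 'End(E)).
Hypothesis g_comp : forall k : nat, component g k%:Z = C k.+1.
Hypothesis g_const : component g (-1) = (phi @: X 0)%VS.
Hypothesis g_big : forall k, (top_degree g < k)%N -> C k.+1 = 0%VS.
Hypothesis phi_parity : {in X 0, forall u, has_parity true (phi u)}.
Hypothesis phi_deg0 : {in C 1 & X 0, forall D u, sbracket D (phi u) = phi (sbracket D u)}.
Hypothesis phi_deg1 : forall p, {in C p.+2 & X 0, forall D u, sbracket D (phi u) = sbracket D u}.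

Variables (sm1 s0 : {vspace E}).
Hypotheses (sm1_sub : (sm1 <= component g (-1))%VS) (sm1_neq0 : sm1 <> 0%VS).
Hypothesis sm1_proper : sm1 <> component g (-1).
Hypothesis s0_max : maximal_solvable_preserving g sm1 s0.

Definition const_part Z : {vspace E} := (X 0 :&: (phi @^-1: Z))%VS.
Local Notation W := (const_part sm1).
Local Notation S := (prolong_comp G W s0).

Lemma const_partP Z u : (u \in const_part Z) = (u \in X 0) && (phi u \in Z).
Proof. by rewrite memv_cap -memv_preim. Qed.

Lemma const_partK Z : (Z <= component g (-1))%VS -> (phi @: const_part Z)%VS = Z.
Proof.
rewrite g_const => /subvP ZX; apply/eqP; rewrite eqEsubv; apply/andP; split.
  by apply/subvP => _ /memv_imgP[u + ->]; rewrite const_partP => /andP[].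
apply/subvP => z zZ; have /memv_imgP[u uX e] := ZX _ zZ.
by rewrite e memv_img // const_partP uX -e.
Qed.

Lemma sm1P u : u \in sm1 -> exists w, [/\ w \in W, w \in X 0 & u = phi w].
Proof.
rewrite -{1}(const_partK sm1_sub) => /memv_imgP[w wW ->]; exists w; split=> //.
by move: wW; rewrite const_partP => /andP[].
Qed.

Lemma phi_sm1 w : w \in W -> phi w \in sm1.
Proof. by rewrite const_partP => /andP[]. Qed.

Lemma const_sub : (W <= X 0)%VS. Proof. exact: capvSl. Qed.

Lemma const_neq0 : W != 0%VS.
Proof. by apply/eqP => W0; apply: sm1_neq0; rewrite -(const_partK sm1_sub) W0 limg0. Qed.

Lemma const_proper : W != X 0.
Proof. by apply/eqP => W0; apply: sm1_proper; rewrite -(const_partK sm1_sub) W0 g_const. Qed.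

Lemma stable_transport T : (T <= C 1)%VS ->
  (brspan T sm1 <= sm1)%VS <-> (brspan T W <= W)%VS.
Proof.
move=> TC; split=> /brspanP h; apply/brspanP => D u DT.
  rewrite !const_partP => /andP[uX uZ]; have DC := subvP TC _ DT.
  have DX := subvP (cartan_sub _ _ _ _) _ DC.
  by rewrite (vect0_const DX uX) -phi_deg0 // h.
case/sm1P=> w [wW wX ->].
by rewrite phi_deg0 ?(subvP TC) //; apply: phi_sm1; apply: h.
Qed.

Lemma g_comp0 : component g 0 = C 1. Proof. exact: (g_comp 0). Qed.

Lemma cartan_deg0 : component G 0 = C 1. Proof. by []. Qed.

Lemma s0_max_cartan : maximal_solvable_preserving G W s0.
Proof.
have key T : solvable_preserving g sm1 T <-> solvable_preserving G W T.
  split=> -[[h1 h2 h3] h4 h5]; split=> //.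
  - by split=> //; rewrite cartan_deg0 -g_comp0.
  - by apply/stable_transport => //; rewrite -g_comp0.
  - by split=> //; rewrite g_comp0.
  by apply/stable_transport => //; rewrite -cartan_deg0.
case: s0_max => /key h1 h2; split=> // T /key; exact: h2.
Qed.

(** Bracketing a field of positive degree with phi u or with u is the same. *)
Lemma prolong_comp_transport k : prolong_comp g sm1 s0 k = S k.
Proof.
elim: k => //= k ->; rewrite g_comp -[k.+1%:Z]degS; apply/vspaceP => D.
rewrite !memv_cap; case DC: (D \in _) => //=; apply/bracket_intoP/bracket_intoP => h w.
  rewrite const_partP => /andP[wX wZ]; rewrite -(phi_deg1 DC wX); exact: h.
by case/sm1P=> u [uW uX ->]; rewrite (phi_deg1 DC uX); apply: h.
Qed.

Lemma prolong_comp_top k : (top_degree g < k)%N -> S k = 0%VS.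
Proof.
move=> tk; apply/eqP; rewrite -subv0 -(g_big tk).
by apply: prolong_comp_sub; apply: max_sub s0_max_cartan.
Qed.

Lemma prolong_tail : prolong g sm1 s0 = (sm1 + tail s W s0 0)%VS.
Proof.
congr (_ + _)%VS; apply/eqP; rewrite eqEsubv; apply/andP; split; apply/subv_sumP => k _.
  by rewrite prolong_comp_transport; apply: tail_sup => //; apply: max_sub s0_max_cartan.
have [kt|tk] := ltnP k (top_degree g).+1; last by rewrite prolong_comp_top ?sub0v.
by apply: (sumv_sup (Ordinal kt)) => //; rewrite prolong_comp_transport.
Qed.

Lemma prolong_comp_le k : (S k <= prolong g sm1 s0)%VS.
Proof.
rewrite prolong_tail; apply: subv_trans (addvSr _ _); apply: tail_sup => //.
exact: max_sub s0_max_cartan.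
Qed.

Lemma sm1_le : (sm1 <= prolong g sm1 s0)%VS.
Proof. exact: addvSl. Qed.

Lemma component_pred j :
  component g (j%:Z - 1) = if j is k.+1 then C k.+1 else (phi @: X 0)%VS.
Proof. case: j => [|k]; [exact: g_const | by rewrite [in LHS]degS; apply: g_comp]. Qed.

(** Degree 0 first, then degree -1, then the positive degrees by induction. *)
Lemma graded_above t : graded_solvable g t -> (prolong g sm1 s0 <= t)%VS ->
  t = prolong g sm1 s0.
Proof.
move=> [[_ _ tt] tgr tsol] pt; have hmax := s0_max_cartan.
have sC := max_sub hmax.
have tbr D D' : D \in t -> D' \in t -> sbracket D D' \in t.
  by move=> Dt D't; apply: (subvP tt); apply: brspan_mem.
have St k : (S k <= t)%VS := subv_trans (prolong_comp_le k) pt.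
have T0 : (t :&: C 1)%VS = s0.
  apply: (solvable_above_max Ksplit K0 const_sub hmax).
  - exact: capvSr.
  - exact: solvableS (capvSl _ _) tsol.
  - apply/brspanP => D D'; rewrite !memv_cap => /andP[Dt DC] /andP[D't D'C].
    by rewrite tbr //=; apply: (@cartan_sbracket _ _ _ 0 0).
  by rewrite subv_cap sC andbT; apply: (St 0).
pose V1 := const_part (t :&: component g (-1)).
have V1P u : u \in V1 -> u \in X 0 /\ phi u \in t.
  by rewrite const_partP memv_cap => /and3P[].
have V1W : V1 = W.
  apply: (degree_minus_one Ksplit K0 const_sub const_neq0 hmax) => //.
  - apply/subvP => w; rewrite !const_partP memv_cap => /andP[-> h] /=.
    rewrite (subvP sm1_sub) // andbT; apply: (subvP pt); rewrite /prolong.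
    by apply: (subvP (addvSl _ _)).
  - exact: capvSl.
  - apply/brspanP => D u Ds /V1P[uX ut]; have DC := subvP sC _ Ds.
    have DX := subvP (cartan_sub _ _ _ _) _ DC.
    have DuX := vect0_const DX uX.
    have et : phi (sbracket D u) \in t.
      by rewrite -phi_deg0 //; apply: tbr => //; apply: (subvP (St 0)).
    by rewrite const_partP DuX memv_cap et g_const memv_img.
  move=> D u DS /V1P[uX ut]; have DC := subvP (prolong_comp_sub _ sC 1) _ DS.
  rewrite -T0 memv_cap (cartan_sbracket_const DC uX) andbT -(phi_deg1 DC uX).
  by apply: tbr => //; apply: (subvP (St 1)).
have Tk k : (t :&: C k.+1 <= S k)%VS.
  elim: k => [|k IH]; first by rewrite T0.
  apply/subvP => D; rewrite memv_cap => /andP[Dt DC]; apply/prolong_compS; split=> // w wW.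
  have [wX wt] : w \in X 0 /\ phi w \in t by apply: V1P; rewrite V1W.
  apply: (subvP IH); rewrite memv_cap.
  by rewrite (cartan_sbracket_const DC wX) -(phi_deg1 DC wX) tbr.
apply/eqP; rewrite eqEsubv pt andbT {1}tgr; apply/subv_sumP => j _.
rewrite component_pred; case: (nat_of_ord j) => [|k]; last first.
  exact: subv_trans (Tk k) (prolong_comp_le k).
rewrite -g_const -(const_partK (capvSr t _)) -/V1 V1W (const_partK sm1_sub).
exact: addvSl.
Qed.

Hypothesis g_carrier : (prolong g sm1 s0 <= g)%VS.
Hypothesis phi_sbracket : (brspan sm1 sm1 <= tail s W s0 0)%VS.
Hypothesis g_solvable : lie_solvable (prolong g sm1 s0).

Lemma prolong_graded : is_graded g (prolong g sm1 s0).
Proof.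
apply/eqP; rewrite eqEsubv; apply/andP; split; last first.
  by apply/subv_sumP => j _; apply: capvSl.
rewrite {1}/prolong subv_add; apply/andP; split.
  apply: (sumv_sup (@ord0 (top_degree g).+1)) => //.
  by rewrite subv_cap component_pred /= -g_const sm1_sub andbT addvSl.
apply/subv_sumP => k _; rewrite prolong_comp_transport.
apply: (sumv_sup (lift ord0 k)) => //; rewrite subv_cap prolong_comp_le lift0 component_pred.
by apply: prolong_comp_sub; apply: max_sub s0_max_cartan.
Qed.

Lemma prolong_op_part a D : D \in prolong g sm1 s0 -> op_part a D \in prolong g sm1 s0.
Proof.
have opD : {morph @op_part K n a : x y / x + y >-> x + y}.
  by move=> x y; have := op_part_linear a 1 x y; rewrite !scale1r.
have op0 : op_part a 0 = 0 :> E.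
  by have := op_part_linear a (-1) 0 (0 : E); rewrite scaler0 addr0 scaleN1r addNr.
rewrite {1}/prolong => /memv_addP[u us [v vs ->]]; rewrite opD; apply: memvD.
  have [w [wW wX e]] := sm1P us.
  have {}us : phi w \in prolong g sm1 s0 by apply: (subvP sm1_le); apply: phi_sm1.
  rewrite e; have [->|] := eqVneq a true; first by rewrite (op_part_id (phi_parity wX)).
  by case: (a) => // _; rewrite (op_part0 (phi_parity wX)) mem0v.
case/memv_sumP: vs => vs hvs ->; rewrite (big_morph _ opD op0); apply: memv_suml => k _.
apply: (subvP (prolong_comp_le k)); have := hvs k isT; rewrite prolong_comp_transport.
apply: (@op_part_mem _ _ k.+1); apply: subv_trans (cartan_sub _ _ _ _).
by apply: prolong_comp_sub; apply: max_sub s0_max_cartan.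
Qed.

Lemma prolong_closed : (brspan (prolong g sm1 s0) (prolong g sm1 s0) <= prolong g sm1 s0)%VS.
Proof.
have hmax := s0_max_cartan; have sC := max_sub hmax.
have SX k : (S k <= X k.+1)%VS := subv_trans (prolong_comp_sub _ sC k) (cartan_sub _ _ _ _).
have SW k D u : D \in S k -> u \in sm1 -> sbracket D u \in prolong g sm1 s0.
  move=> DS /sm1P[w [wW wX ->]].
  have DC := subvP (prolong_comp_sub _ sC k) _ DS.
  case: k DS DC => [|k] DS DC.
    rewrite phi_deg0 //; apply: (subvP sm1_le).
    by apply: phi_sm1; apply: (subvP (max_stable hmax)); apply: brspan_mem.
  rewrite (phi_deg1 DC wX); apply: (subvP (prolong_comp_le k)).
  by case/prolong_compS: DS => _; apply.
have WS k D u : D \in S k -> u \in sm1 -> sbracket u D \in prolong g sm1 s0.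
  move=> DS us; have := SW _ _ _ DS us; have [w [_ wX ->]] := sm1P us.
  rewrite (sbracketC (phi_parity wX) (vect_deg_parity (subvP (SX k) _ DS))).
  exact: memvZ.
rewrite {1 2}prolong_tail; apply: brspan_addl; apply: brspan_addr.
- by apply: subv_trans phi_sbracket _; rewrite prolong_tail addvSr.
- rewrite /tail; elim/big_rec: _ => [|k Z _ hZ].
    by apply/brspanP => D D' _; rewrite memv0 => /eqP->; rewrite sbracket0r mem0v.
  by apply: brspan_addr => //; apply/brspanP => u D us DS; apply: WS DS us.
- rewrite /tail; elim/big_rec: _ => [|k Z _ hZ].
    by apply/brspanP => D D'; rewrite memv0 => /eqP->; rewrite sbracket0l mem0v.
  by apply: brspan_addl => //; apply/brspanP => D u; apply: SW.
apply: brspan_sums => i j _ _; apply: subv_trans (prolong_comp_le (i + j)).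
apply/brspanP => D D'; apply: prolong_sbracket => //.
- exact: const_sub.
- exact: max_closed hmax.
exact: max_stable hmax.
Qed.

Lemma prolong_maximal : maximal_solvable g (prolong g sm1 s0).
Proof.
split; last exact: graded_above.
split; [split|exact: prolong_graded|exact: g_solvable].
- exact: g_carrier.
- exact: prolong_op_part.
exact: prolong_closed.
Qed.

End Transport.

(** * The three families *)

Section Families.
Variables (K : fieldType) (n : nat).
Hypotheses (Ksplit : split_polys K) (K0 : char_zero K) (n3 : (2 < n)%N).
Local Notation L := (grassmann K n).
Local Notation E := 'End(L).
Local Notation Xi := (Xi K n).
Local Notation H p := (homog K n p%:Z).
Local Notation X p := (vect_deg K n (p%:Z - 1)).
Implicit Types (f h : L) (T U Z : {vspace E}) (D u v w : E).

Lemma vect_deg_carrier d : (vect_deg K n d <= vect_space K n)%VS.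
Proof. by apply/subv_sumP => i _; apply: (sumv_sup i) => //; apply: limgS (subvf _). Qed.

Lemma cartan_carrier s p : (component (cartan K n s) (p%:Z - 1) <= cartan K n s)%VS.
Proof.
case: s => /=; last exact: vect_deg_carrier.
by apply: capvS => //; apply: vect_deg_carrier.
Qed.

Lemma const_part_id sm1 : (sm1 <= X 0)%VS -> const_part \1%VF sm1 = sm1.
Proof.
move=> sX; apply/vspaceP => u; rewrite const_partP id_lfunE.
by case h: (u \in sm1); rewrite ?andbF // (subvP sX).
Qed.

Lemma cartan_maximal s sm1 s0 : let g := cartan K n s in
  (sm1 <= component g (-1))%VS -> sm1 <> 0%VS -> sm1 <> component g (-1) ->
  maximal_solvable_preserving g sm1 s0 -> maximal_solvable g (prolong g sm1 s0).
Proof.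
move=> g sub nz pr max.
have gc : component g (-1) = X 0 by exact: cartan_const.
have sX : (sm1 <= X 0)%VS by rewrite -gc.
have comp k : component g k%:Z = component (cartan K n s) (k.+1%:Z - 1) by rewrite degS.
have const : component g (-1) = (\1%VF @: X 0)%VS by rewrite lim1g gc.
have top : top_degree g = n.-1 by rewrite /g /cartan; case: (s).
have big k : (top_degree g < k)%N -> component (cartan K n s) (k.+1%:Z - 1) = 0%VS.
  rewrite top => nk; apply/eqP; rewrite -subv0; apply/subvP => D.
  move=> /(subvP (cartan_sub _ _ _ _)) /vect_deg_big ->; rewrite ?mem0v //.
  by move: nk; case: (n) n3.
have par : {in X 0, forall u, has_parity true ((\1%VF : 'End(E)) u)}.
  by move=> u /vect_deg_parity; rewrite id_lfunE.
have deg0 : {in component (cartan K n s) (1%:Z - 1) & X 0, forall D u,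
    sbracket D ((\1%VF : 'End(E)) u) = (\1%VF : 'End(E)) (sbracket D u)}.
  by move=> D u _ _; rewrite !id_lfunE.
have deg1 p : {in component (cartan K n s) (p.+2%:Z - 1) & X 0, forall D u,
    sbracket D ((\1%VF : 'End(E)) u) = sbracket D u}.
  by move=> D u _ _; rewrite id_lfunE.
have max' := s0_max_cartan comp const deg0 sub max.
have ptail := prolong_tail comp const big deg0 deg1 sub max.
rewrite const_part_id // in max' ptail.
apply: (prolong_maximal Ksplit K0 n3 comp const big par deg0 deg1 sub nz max).
- rewrite /prolong subv_add; apply/andP; split; first exact: subv_trans sub (cartan_carrier s 0).
  apply/subv_sumP => k _; apply: subv_trans (cartan_carrier s k.+1).
  by apply: prolong_comp_sub; apply: max_sub max'.
- apply/brspanP => u v /(subvP sX) uX /(subvP sX) vX.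
  by rewrite (const_sbracket uX vX) mem0v.
rewrite ptail; apply: (prolong_solvable Ksplit K0) => //.
- exact: max_sub max'.
- exact: max_closed max'.
- exact: max_stable max'.
exact: max_solvable max'.
Qed.

Hypothesis n_even : ~~ odd n.

Lemma mulXi1E u : mulXi1 K n u = u + fmul Xi u.
Proof.
by apply/lfunP => f; rewrite lfunE /= comp_lfunE lmulE add_lfunE fmulE mulrDl mul1r.
Qed.

Lemma const_span : X 0 = <<[seq pder K i | i : 'I_n]>>%VS.
Proof.
apply/eqP; rewrite eqEsubv; apply/andP; split.
  apply/subvP => u /const_expand ->; apply: memv_suml => i _; apply: memvZ.
  by apply: memv_span; apply: image_f.
by apply/span_subvP => _ /imageP[i _ ->]; apply: pderX.
Qed.

Lemma tsvect_const : component (tsvect K n) (-1) = (mulXi1 K n @: X 0)%VS.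
Proof.
rewrite const_span limg_span -map_comp; congr span; apply: eq_map => i /=.
by rewrite mulXi1E; apply/lfunP => f; rewrite fpderE add_lfunE fmulE mulrDl mul1r.
Qed.

(** By the Leibniz rule, as D kills Xi when it is divergence-free of degree 0. *)
Lemma sbracket_mulXi1_deg0 D u : D \in X 1 -> divergence K n D = 0 -> u \in X 0 ->
  sbracket D (mulXi1 K n u) = mulXi1 K n (sbracket D u).
Proof.
move=> DX dD uX; rewrite !mulXi1E sbracketDr; congr (_ + _); apply/lfunP => f.
have XuX := fmul_vect (homog_Xi K n) uX; rewrite addn0 in XuX.
rewrite (vect_degE _ DX XuX) !fmulE (vect_degE _ DX uX) /= !expr0 !scale1r.
have /vect_degP[[_ ->] _] := DX; rewrite /= (vect0_Xi DX) dD oppr0 !mul0r add0r.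
by rewrite mulrBr.
Qed.

Lemma sbracket_mulXi1_pos p D u : D \in X p.+2 -> u \in X 0 ->
  sbracket D (mulXi1 K n u) = sbracket D u.
Proof.
move=> DX uX; rewrite mulXi1E sbracketDr.
have XuX := fmul_vect (homog_Xi K n) uX.
rewrite (vect_deg_big _ (vect_deg_sbracket DX XuX)) ?addr0 //.
by rewrite addn0 addSn /= addSn ltnS leq_addl.
Qed.

(** Differentiate f Xi = 0 along v. *)
Lemma Xi_divisible f v : f \in H 1 -> v \in X 0 -> v f = 1 -> Xi = f * v Xi.
Proof.
move=> fH vX fv; have := congr1 v (linear_Xi fH).
rewrite linear0 const_mul // fv mul1r (homog_sigma fH) expr1 scaleN1r mulNr.
by move/eqP; rewrite subr_eq0 => /eqP.
Qed.

Section Deformed.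
Variables (W s0 : {vspace E}).
Hypotheses (WX : (W <= X 0)%VS) (hmax : maximal_solvable_preserving (cartan K n true) W s0).
Local Notation S s := (prolong_comp (cartan K n s) W s0).

Lemma s0_cartan s : (s0 <= component (cartan K n s) (1%:Z - 1))%VS.
Proof.
have h := max_sub hmax; case: s => //.
by apply: subv_trans h _; apply: capvSl.
Qed.

Lemma svect_prolongP k D : D \in S true k <->
  D \in component (cartan K n true) (k.+1%:Z - 1) /\ D \in S false k.
Proof.
elim: k D => [|k IH] D.
  by split=> [h|[]//]; split=> //; apply: (subvP (max_sub hmax)).
split=> [/prolong_compS[DC h]|[DC /prolong_compS[_ h]]].
  split=> //; apply/prolong_compS; split; first by apply: (subvP (cartan_sub _ _ _ _)) DC.
  by move=> w wW; have /IH[] := h w wW.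
apply/prolong_compS; split=> // w wW; apply/IH; split; last exact: h.
by apply: cartan_sbracket_const DC _; apply: (subvP WX).
Qed.

(** Coefficients divisible by a linear form f that vanishes on W give elements
    g (x) w of the prolong, since the ideal of f is stable under W. *)
Lemma ideal_prolong f k h w : f \in H 1 -> {in W, forall u, u f = 0} ->
  f * h \in H k.+1 -> w \in W -> fmul (f * h) w \in S false k.
Proof.
move=> fH fW + wW; have wX := subvP WX _ wW.
have der u g : u \in W -> u (f * g) = f * - u g.
  move=> uW; rewrite const_mul ?(subvP WX) // fW // mul0r add0r.
  by rewrite (homog_sigma fH) expr1 scaleN1r mulNr mulrN.
elim: k h => [|k IH] h hH.
  apply: (nilradical_sub WX hmax hH _ wW) => u uW.
  have uX := subvP WX _ uW; rewrite (const_eval uX hH) (der _ _ uW).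
  rewrite ffunE big1 ?scale0r // => A; rewrite subset0 => /eqP->.
  have /homogP -> : f \in H 1 by []; last by rewrite cards0.
  by rewrite mul0r mulr0.
apply/prolong_compS; split=> [|u uW].
  by apply/cartanP; split=> //; have := fmul_vect hH wX; rewrite addn0.
have uX := subvP WX _ uW.
rewrite (sbracket_fmul_const hH wX uX); apply: memvZ; rewrite der //; apply: IH.
by rewrite -der //; have := vect_deg_homog uX hH.
Qed.

Lemma full_prolong_solvable : lie_solvable (full_prolong false W s0).
Proof.
apply: (prolong_solvable Ksplit K0) => //.
- exact: s0_cartan.
- exact: max_closed hmax.
- exact: max_stable hmax.
exact: max_solvable hmax.
Qed.

Hypothesis W_proper : W != X 0.

Lemma form_on_W : exists f v, [/\ f \in H 1, v \in X 0, {in W, forall u, u f = 0} & v f = 1].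
Proof.
have /subvPn[v vX vW] : ~~ (X 0 <= W)%VS.
  by apply: contra W_proper => h; rewrite eqEsubv WX.
by have [f [fH fW fv]] := exists_form WX vX vW; exists f, v.
Qed.

Lemma Xi_prolong w : w \in W -> fmul Xi w \in S false n.-1.
Proof.
move=> wW; have [f [v [fH vX fW fv]]] := form_on_W.
have e := Xi_divisible fH vX fv.
have nn : n.-1.+1 = n by case: (n) n3.
by rewrite e; apply: ideal_prolong => //; rewrite -e nn homog_Xi.
Qed.

Lemma deformed_const_sub : (mulXi1 K n @: W <= full_prolong false W s0)%VS.
Proof.
apply/subvP => _ /memv_imgP[w wW ->]; rewrite mulXi1E; apply: memvD.
  by apply: (subvP (addvSl _ _)).
apply: (subvP (addvSr _ _)); apply: (subvP (@tail_sup _ _ _ _ _ (s0_cartan false) 0 n.-1 _)) => //.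
exact: Xi_prolong.
Qed.

(** The bracket is u(Xi) w + w(Xi) u: the term without Xi vanishes, that with two
    factors Xi has too large a degree, and u(Xi) is divisible by the form f. *)
Lemma deformed_sbracket u w : u \in W -> w \in W ->
  sbracket (mulXi1 K n u) (mulXi1 K n w) \in S true n.-2.
Proof.
move=> uW wW; have uX := subvP WX _ uW; have wX := subvP WX _ wW.
have [f [v [fH vX fW fv]]] := form_on_W.
have e := Xi_divisible fH vX fv.
have XX x : x \in X 0 -> fmul Xi x \in X n.
  by move=> xX; have := fmul_vect (homog_Xi K n) xX; rewrite addn0.
have nn : n.-2.+1 = n.-1 by case: (n) n3 => [|[]].
have br x y : x \in X 0 -> y \in X 0 -> sbracket (fmul Xi x) y = fmul (y Xi) x.
  move=> xX yX; rewrite (sbracket_fmul_const (homog_Xi K n) xX yX) n_even expr1.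
  by rewrite opprK scale1r.
have -> : sbracket (mulXi1 K n u) (mulXi1 K n w) = fmul (u Xi) w + fmul (w Xi) u.
  rewrite !mulXi1E sbracketDl !sbracketDr (const_sbracket uX wX) add0r (br _ _ uX wX).
  rewrite (vect_deg_big _ (vect_deg_sbracket (XX _ uX) (XX _ wX))) ?addr0; last first.
    by move: n3; case: (n) => // m m2; rewrite addSn /= -{1}[m.+1]add0n ltn_add2r; case: m m2.
  congr (_ + _); rewrite (sbracketC (vect_deg_parity uX) (vect_deg_parity (XX _ wX))).
  by rewrite n_even expr1 opprK scale1r (br _ _ wX uX).
have HX x : x \in X 0 -> x Xi \in H n.-1 by move=> xX; apply: (vect_deg_homog xX (homog_Xi K n)).
have FX x y : x \in X 0 -> y \in X 0 -> fmul (x Xi) y \in X n.-1.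
  by move=> xX yX; have := fmul_vect (HX _ xX) yX; rewrite addn0.
apply/svect_prolongP; rewrite nn; split.
  apply/cartanP; split=> [|_]; first by apply: memvD; apply: FX.
  rewrite linearD /= (div_fmul (HX _ uX) wX) (div_fmul (HX _ wX) uX).
  by rewrite -scalerDr (const_anticomm _ wX uX) addNr scaler0.
have S1 x y : x \in W -> y \in W -> fmul (x Xi) y \in S false n.-2.
  move=> xW yW; have xX := subvP WX _ xW.
  have ex : x Xi = f * - x (v Xi).
    rewrite {1}e const_mul // fW // mul0r add0r (homog_sigma fH) expr1 scaleN1r.
    by rewrite mulNr mulrN.
  by rewrite ex; apply: ideal_prolong => //; rewrite -ex nn HX.
by apply: memvD; apply: S1.
Qed.

End Deformed.

(** If D has degree n - 1, each xi_j (d_i D xi_i) is D xi_j or 0 according to whether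
    i = j, so Div D = 0 forces D = 0. *)
Lemma svect_top k : (n.-2 < k)%N -> component (cartan K n true) (k.+1%:Z - 1) = 0%VS.
Proof.
move=> nk; apply/eqP; rewrite -subv0; apply/subvP => D /cartanP[DX /(_ isT) dD].
have : (n <= k.+1)%N by move: nk; case: (n) n3 => [|[]].
rewrite leq_eqVlt => /orP[/eqP en|nk1]; last by rewrite (vect_deg_big nk1 DX) mem0v.
rewrite -en in DX.
suff D0 j : D (xi K j) = 0.
  rewrite (vect_deg_expand DX) big1 ?mem0v // => j _.
  by rewrite D0 linear0.
have /vect_degP[_ hD] := DX.
have xd i : xi K j * pder K i (D (xi K i)) = D (xi K i) *+ (i == j).
  have z : xi K j * D (xi K i) = 0.
    by apply: homog_big (homogM (homog_xi K j) (hD i)); rewrite add1n.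
  have := congr1 (pder K i) z; rewrite linear0 pder_xiM => /eqP.
  by rewrite subr_eq0 => /eqP.
have := congr1 (fun f => xi K j * f) dD; rewrite /= mulr0 divE.
rewrite (eq_bigr (fun i => (-1) ^+ n *: pder K i (D (xi K i)))) => [|i _]; last first.
  by rewrite (homog_sigma (hD i)) linearZ.
rewrite -scaler_sumr -scalerAr mulr_sumr (bigD1 j) //= xd eqxx big1 ?addr0 => [/eqP|i nij].
  by rewrite scaler_eq0 signr_eq0 => /eqP.
by rewrite xd (negPf nij).
Qed.

Lemma mulXi1_pos k D : D \in X k.+1 -> mulXi1 K n D = D.
Proof.
move=> DX; rewrite mulXi1E (vect_deg_big _ (fmul_vect (homog_Xi K n) DX)) ?addr0 //.
by rewrite addnS ltnS leq_addr.
Qed.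

Lemma tsvect_maximal sm1 s0 : let g := tsvect K n in (3 < n)%N ->
  (sm1 <= component g (-1))%VS -> sm1 <> 0%VS -> sm1 <> component g (-1) ->
  maximal_solvable_preserving g sm1 s0 -> maximal_solvable g (prolong g sm1 s0).
Proof.
move=> g n4 sub nz pr max.
have comp k : component g k%:Z = component (cartan K n true) (k.+1%:Z - 1) by rewrite degS.
have const := tsvect_const; rewrite -/g in const.
have big k : (top_degree g < k)%N -> component (cartan K n true) (k.+1%:Z - 1) = 0%VS.
  exact: svect_top.
have par : {in X 0, forall u, has_parity true (mulXi1 K n u)}.
  move=> u uX b f; have pu := vect_deg_parity uX.
  have XuX := fmul_vect (homog_Xi K n) uX; rewrite addn0 in XuX.
  have := vect_deg_parity XuX; rewrite n_even => pX.
  by rewrite mulXi1E !add_lfunE linearD /= pu pX.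
have deg0 : {in component (cartan K n true) (1%:Z - 1) & X 0, forall D u,
    sbracket D (mulXi1 K n u) = mulXi1 K n (sbracket D u)}.
  by move=> D u /cartanP[DX /(_ isT) dD]; apply: sbracket_mulXi1_deg0.
have deg1 p : {in component (cartan K n true) (p.+2%:Z - 1) & X 0, forall D u,
    sbracket D (mulXi1 K n u) = sbracket D u}.
  by move=> D u /cartanP[DX _]; apply: sbracket_mulXi1_pos DX.
have max' := s0_max_cartan comp const deg0 sub max.
have ptail := prolong_tail comp const big deg0 deg1 sub max.
have Wpr := const_proper const sub pr.
have eW := const_partK const sub.
move: max' ptail Wpr eW (const_sub (mulXi1 K n) sm1).
set W := const_part _ _ => max' ptail Wpr eW WX.
have sC := max_sub max'.
apply: (prolong_maximal Ksplit K0 n3 comp const big par deg0 deg1 sub nz max).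
- rewrite ptail subv_add; apply/andP; split.
    rewrite -eW; apply: limgS; apply: subv_trans WX _.
    by have := cartan_carrier true 0; rewrite cartan_const.
  apply/subv_sumP => k _; apply/subvP => D /(subvP (prolong_comp_sub _ sC k)) DC.
  have DX := subvP (cartan_sub _ _ _ _) _ DC.
  rewrite -(mulXi1_pos DX); apply: memv_img.
  exact: (subvP (cartan_carrier true k.+1)).
- rewrite -{1 2}eW; apply/brspanP => _ _ /memv_imgP[u uW ->] /memv_imgP[w wW ->].
  apply: (subvP (@tail_sup _ _ _ _ _ sC 0 n.-2 _)) => //.
  exact: deformed_sbracket.
apply: solvableS (full_prolong_solvable WX max').
rewrite ptail subv_add -{1}eW (deformed_const_sub WX max' Wpr) /=.
apply: subv_trans (addvSr _ _); apply/subv_sumP => k _.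
apply: subv_trans (_ : prolong_comp (cartan K n false) W s0 k <= _)%VS.
  by apply/subvP => D /(svect_prolongP WX max')[].
by apply: tail_sup => //; apply: s0_cartan max' false.
Qed.

End Families.

Lemma prolong_maximal_solvable (K : fieldType) (N : nat) (g : graded_vf K N)
    (sm1 s0 : {vspace 'End(grassmann K N)}) :
  split_polys K -> char_zero K ->
  ((3 <= N)%N /\ (g = vect K N \/ g = svect K N)) \/
    (exists n : nat, [/\ (2 <= n)%N, N = n.*2 & g = tsvect K N]) ->
  (sm1 <= component g (-1))%VS -> sm1 <> 0%VS -> sm1 <> component g (-1) ->
  maximal_solvable_preserving g sm1 s0 -> maximal_solvable g (prolong g sm1 s0).
Proof.
move=> Ksplit K0 [[N3 [->|->]]|[m [m2 eN ->]]].
- exact: (@cartan_maximal _ _ Ksplit K0 N3 false).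
- exact: (@cartan_maximal _ _ Ksplit K0 N3 true).
have N4 : (3 < N)%N by rewrite eN -(leq_double 2) in m2 *.
by apply: tsvect_maximal => //; rewrite ?eN ?odd_double // -eN ltnW.
Qed.

Theorem proposition5p3 (R : realType) (N : nat) (g : graded_vf R[i] N)
    (hg : ((3 <= N)%N /\ (g = vect R[i] N \/ g = svect R[i] N)) \/
          (exists n : nat, [/\ (2 <= n)%N, N = n.*2 & g = tsvect R[i] N]))
    (sm1 s0 : {vspace 'End(grassmann R[i] N)})
    (hsub : (sm1 <= component g (-1))%VS)
    (hnonzero : sm1 <> 0%VS)
    (hproper : sm1 <> component g (-1))
    (hs0 : maximal_solvable_preserving g sm1 s0) :
  maximal_solvable g (prolong g sm1 s0).
Proof.
apply: prolong_maximal_solvable hg hsub hnonzero hproper hs0.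
- move=> p; have [r e] := @closed_field_poly_normal R[i] p.
  by exists r.
by move=> k; rewrite pnatr_eq0.
Qed.
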